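(* Assume $\lambda_0<\varepsilon-\eta\le0<A-\delta$ and $\rho>(A-\delta)(1-\gamma)$, and let the initial data $(k_0,c_0)$ be such that the initial structural state $q=(k_0,\ s\mapsto\varepsilon\int_{-\tau}^sc_0(u-s)e^{\eta u}du)$ belongs to $I$. Then the unique optimal pair $(k^*,c^* )$ of the internal habit problem (P) is the unique admissible pair satisfying, for all $t\ge0$, the closed-loop policy of the external habit economy $$\frac{c(t)-h(t)}{A-\delta-\Gamma}=k(t)-\frac{1}{A-\delta+\eta}\Big[h(t)+\varepsilon\big(1-e^{-(A-\delta+\eta)\tau}\big)k(t)-\varepsilon e^{-\eta\tau}e^{-(A-\delta)\tau}\int_{t-\tau}^{t}e^{-(A-\delta)(u-t)}\widetilde c(u)\,du\Big],$$ with $\Gamma=\frac{A-\delta-\rho}{\gamma}$. Consequently, with subtractive nonseparable utility and linear technology, internal habits and external habits (formed on average economy-wide consumption with the same $\varepsilon,\eta,\tau$) yield the same unique equilibrium path, and this path is Pareto optimal.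
   Context: Parameters $A,\delta,\rho,\varepsilon,\eta,\tau>0$, $\gamma>0$, $\gamma\ne1$; $\lambda_0$ is the unique real root of $1=\varepsilon\int_{-\tau}^0e^{(\lambda+\eta)u}du$. Problem (P) (internal habits): initial data $k_0>0$, $c_0\in L^2([-\tau,0);\mathbb{R}_+)$; for a control $c\ge0$, $\widetilde c$ is the concatenation of $c_0$ and $c$; habit $h(t)=\varepsilon\int_{t-\tau}^t\widetilde c(u)e^{\eta(u-t)}du$; capital $k(t)=k_0e^{(A-\delta)t}-\int_0^te^{(A-\delta)(t-u)}c(u)du$; admissible if $k\ge0$ and $c\ge h$ a.e.; maximize $\int_0^\infty\frac{(c(t)-h(t))^{1-\gamma}}{1-\gamma}e^{-\rho t}dt$. In the external habit economy the same utility is used but $h$ is formed from average consumption $\bar c$, taken as given by households; its market equilibrium (from prior work) is characterized by the displayed closed-loop policy. $G(x)=\big(1-\varepsilon\int_{-\tau}^0e^{(A-\delta+\eta)s}ds\big)x_0-\int_{-\tau}^0e^{(A-\delta)s}x_1(s)ds$ for $x=(x_0,x_1)\in\mathbb{R}\times L^2([-\tau,0])$; $I=\{x: G(x)>0,\ x_1\in W^{1,2}([-\tau,0]),\ x_1(-\tau)=0,\ x_1(s)>0\ \forall s\in(-\tau,0]\}$. *)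

(* Defs.v *)
From HB Require Import structures.
From mathcomp Require Import all_boot all_order all_algebra.
From mathcomp Require Import all_classical all_reals all_analysis.
Set Implicit Arguments.
Unset Strict Implicit.
Unset Printing Implicit Defensive.
Import Order.TTheory GRing.Theory Num.Theory.
Local Open Scope classical_set_scope.
Local Open Scope ring_scope.

Definition ctilde (R : realType) (c0 c : R -> R) (u : R) : R :=
  if u < 0 then c0 u else c u.

Definition habit (R : realType) (eps eta tau : R) (c0 c : R -> R) (t : R) : R :=
  eps * Rintegral lebesgue_measure `[t - tau, t]%classic
          (fun u => ctilde c0 c u * expR (eta * (u - t))).

Definition capital (R : realType) (A delta k0 : R) (c : R -> R) (t : R) : R :=
  k0 * expR ((A - delta) * t)
  - Rintegral lebesgue_measure `[0, t]%classic
      (fun u => expR ((A - delta) * (t - u)) * c u).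

(* utility (x)^{1-gam}/(1-gam), extended-real valued; at x <= 0 (only x = 0 is
   relevant for admissible controls) it is the limit value: 0 if gam < 1 and
   -oo if gam > 1 *)
Definition util (R : realType) (gam : R) (x : R) : \bar R :=
  if 0 < x then ((x `^ (1 - gam)) / (1 - gam))%:E
  else if gam < 1 then 0%E else (-oo)%E.

Definition objective (R : realType) (eps eta tau rho gam : R) (c0 c : R -> R)
  : \bar R :=
  (\int[lebesgue_measure]_(t in [set t : R | (0 <= t)%R])
     (util gam (c t - habit eps eta tau c0 c t)%R * (expR (- rho * t)%R)%:E))%E.

Definition past_consumption (R : realType) (tau : R) (c0 : R -> R) : Prop :=
  measurable_fun `[- tau, 0[%classic c0 /\
  (forall s, - tau <= s < 0 -> 0 <= c0 s) /\
  lebesgue_measure.-integrable `[- tau, 0[%classic (fun s => ((c0 s) ^+ 2)%:E).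

Definition control (R : realType) (c : R -> R) : Prop :=
  measurable_fun [set t : R | 0 <= t] c /\
  (forall t, 0 <= t -> 0 <= c t) /\
  (forall T, 0 <= T ->
     lebesgue_measure.-integrable `[0, T]%classic (fun t => (c t)%:E)).

Definition admissible (R : realType) (A delta eps eta tau k0 : R)
  (c0 c : R -> R) : Prop :=
  control c /\
  (forall t, 0 <= t -> 0 <= capital A delta k0 c t) /\
  {ae lebesgue_measure, forall t, 0 <= t -> habit eps eta tau c0 c t <= c t}.

Definition optimal (R : realType) (A delta rho eps eta tau gam k0 : R)
  (c0 c : R -> R) : Prop :=
  admissible A delta eps eta tau k0 c0 c /\
  forall c', admissible A delta eps eta tau k0 c0 c' ->
    (objective eps eta tau rho gam c0 c' <= objective eps eta tau rho gam c0 c)%E.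

Definition W12 (R : realType) (a b : R) (f : R -> R) : Prop :=
  exists g : R -> R,
    measurable_fun `[a, b]%classic g /\
    lebesgue_measure.-integrable `[a, b]%classic (fun s => ((g s) ^+ 2)%:E) /\
    forall s, a <= s <= b ->
      f s = f a + Rintegral lebesgue_measure `[a, s]%classic g.

Definition q1 (R : realType) (eps eta tau : R) (c0 : R -> R) (s : R) : R :=
  eps * Rintegral lebesgue_measure `[- tau, s]%classic
          (fun u => c0 (u - s) * expR (eta * u)).

Definition Gfun (R : realType) (A delta eps eta tau : R) (x0 : R) (x1 : R -> R)
  : R :=
  (1 - eps * Rintegral lebesgue_measure `[- tau, 0]%classic
                (fun s => expR ((A - delta + eta) * s))) * x0
  - Rintegral lebesgue_measure `[- tau, 0]%classic
      (fun s => expR ((A - delta) * s) * x1 s).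

Definition in_I (R : realType) (A delta eps eta tau : R) (x0 : R) (x1 : R -> R)
  : Prop :=
  0 < Gfun A delta eps eta tau x0 x1 /\
  W12 (- tau) 0 x1 /\
  x1 (- tau) = 0 /\
  (forall s, - tau < s <= 0 -> 0 < x1 s).

Definition ext_policy (R : realType) (A delta rho eps eta tau gam k0 : R)
  (c0 c : R -> R) : Prop :=
  let a := A - delta in
  let Gam := (A - delta - rho) / gam in
  forall t, 0 <= t ->
    (c t - habit eps eta tau c0 c t) / (a - Gam) =
    capital A delta k0 c t
    - (a + eta)^-1 *
      (habit eps eta tau c0 c t
       + eps * (1 - expR (- (a + eta) * tau)) * capital A delta k0 c t
       - eps * expR (- eta * tau) * expR (- a * tau)
         * Rintegral lebesgue_measure `[t - tau, t]%classic
             (fun u => expR (- a * (u - t)) * ctilde c0 c u)).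

(* Main.v *)
Require Import Defs.
From HB Require Import structures.
From mathcomp Require Import all_boot all_order all_algebra.
From mathcomp Require Import all_classical all_reals all_analysis.
From mathcomp Require Import measurable_realfun ring lra.
Import Order.TTheory GRing.Theory Num.Theory.
Import numFieldNormedType.Exports.
Local Open Scope classical_set_scope.
Local Open Scope ring_scope.

(* Put a = A - delta, z = c - h, and let V be the right-hand side of the closed-loop
   policy. For every control, V' = a V - z: the delayed terms of h' and of the
   derivative of the integral term cancel. Hence e^{-at} V(t) = G(q) - int_0^t e^{-as} z,
   and as lim inf e^{-at} V(t) >= 0 for admissible controls, these satisfy the budget
   constraint int e^{-at} z <= G(q). Maximising int z^{1-gam}/(1-gam) e^{-rho t} under
   this single constraint is a static concave problem, with unique solution
   z(t) = (a - Gam) G(q) e^{Gam t} by the tangent inequality for power utility; here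
   V(t) = G(q) e^{Gam t}, which is the closed-loop policy. The path with this surplus
   is recovered from the Volterra equation c = z + h, and its capital is positive
   because V is. The policy in turn forces V' = Gam V, hence this surplus. *)

(** * Integrals over bounded intervals *)

(** Controls are only locally integrable, so the habit and the window integral need not be
    differentiable everywhere, while the policy is a condition at every t >= 0. The law V' = a V - z
    is therefore used only in integrated form, obtained from an integration by parts that is itself
    Tonelli on a triangle. The root lambda_0 acts through [kappa], the coefficient of capital in G:
    eps int_{-tau}^0 e^{(l + eta) u} du decreases in l and equals 1 at l = lambda_0 < a, so [kappa]
    is nonnegative. This sign gives both the lower bound on V behind the budget constraint and the
    passage from positive V to nonnegative capital. The condition rho > a (1 - gam) says a > Gam:
    the balanced surplus is positive and has finite present value. Finally, paths that agree a.e.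
    have habits that agree everywhere, and this is how pointwise uniqueness is reached. *)

Section local_integrals.
Local Set Implicit Arguments.
Local Unset Strict Implicit.
Context {R : realType}.
Implicit Types (f g : R -> R) (x y z b : R).
Local Notation mu := (@lebesgue_measure R).

(** Not an oriented integral: it vanishes when [y < x]. Additivity thus needs ordered endpoints, but
    a primitive of a nonnegative function is nonnegative and nondecreasing, hence measurable, on the
    whole line. *)
Definition J f x y : R := Rintegral mu `[x, y] f.

Definition locint f := forall x y, mu.-integrable `[x, y] (EFin \o f).

(** Nonnegativity opens the way to Tonelli and monotone convergence without integrability
    conditions; integrability is local because consumption may grow without bound. *)
Definition density f := [/\ measurable_fun setT f, forall u, 0 <= f u & locint f].

Lemma J_gt f x y : y < x -> J f x y = 0.
Proof. by move=> yx; rewrite /J set_itv_ge ?Rintegral_set0// bnd_simp -ltNge. Qed.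

Lemma J_refl f x : J f x x = 0.
Proof. by rewrite /J set_itv1 Rintegral_set1. Qed.

Lemma eq_J g f x y : (forall u, x <= u <= y -> f u = g u) -> J f x y = J g x y.
Proof. by move=> fg; apply: eq_Rintegral => u; rewrite inE/= in_itv/=; exact: fg. Qed.

Lemma J_ge0 f x y : (forall u, x <= u <= y -> 0 <= f u) -> 0 <= J f x y.
Proof. by move=> f0; apply: Rintegral_ge0 => u/=; rewrite in_itv/=; exact: f0. Qed.

Lemma J_chasles f x y z : locint f -> x <= y -> y <= z ->
  J f x z = J f x y + J f y z.
Proof.
move=> lf xy yz; rewrite /J.
have /eqP := @Rintegral_itvB R f (BLeft x) (BRight z) y (lf x z) xy yz.
by rewrite subr_eq addrC => /eqP ->; rewrite Rintegral_itv_obnd_cbnd//;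
  apply: integrableS (lf y z) => //; exact: subset_itv_oc_cc.
Qed.

Lemma le_J f g x y : locint f -> locint g -> (forall u, x <= u <= y -> f u <= g u) ->
  J f x y <= J g x y.
Proof.
by move=> lf lg fg; apply: le_Rintegral => // u/=; rewrite in_itv/=; exact: fg.
Qed.

Lemma JD f g x y : locint f -> locint g ->
  J (fun u => f u + g u) x y = J f x y + J g x y.
Proof. by move=> lf lg; rewrite /J RintegralD. Qed.

Lemma JB f g x y : locint f -> locint g ->
  J (fun u => f u - g u) x y = J f x y - J g x y.
Proof. by move=> lf lg; rewrite /J RintegralB. Qed.

Lemma JZ k f x y : locint f -> J (fun u => k * f u) x y = k * J f x y.
Proof. by move=> lf; rewrite /J RintegralZl. Qed.

Lemma normr_J f x y : locint f -> `|J f x y| <= J (fun u => `|f u|) x y.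
Proof. by move=> lf; apply: le_normr_Rintegral. Qed.

Lemma EFin_J f x y : locint f -> (J f x y)%:E = (\int[mu]_(u in `[x, y]) (f u)%:E)%E.
Proof. by move=> lf; rewrite /J /Rintegral fineK//; apply: integrable_fin_num => //; exact: lf. Qed.

Lemma locintD f g : locint f -> locint g -> locint (fun u => f u + g u).
Proof. by move=> lf lg x y; have := integrableD _ (lf x y) (lg x y); exact. Qed.

Lemma locintB f g : locint f -> locint g -> locint (fun u => f u - g u).
Proof. by move=> lf lg x y; have := integrableB _ (lf x y) (lg x y); exact. Qed.

Lemma locintZ k f : locint f -> locint (fun u => k * f u).
Proof. by move=> lf x y; have := integrableZl _ k (lf x y); exact. Qed.

Lemma locint_norm f : locint f -> locint (fun u => `|f u|).
Proof. by move=> lf x y; exact: integrable_norm (lf x y). Qed.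

Lemma locint_bounded f : measurable_fun setT f ->
  (forall x y, exists M, forall u, x <= u <= y -> `|f u| <= M) -> locint f.
Proof.
have muitv x y : (mu `[x, y]%classic < +oo)%E.
  by rewrite lebesgue_measure_itv/=; case: ifP => // _; rewrite -EFinB ltry.
move=> mf bf x y; apply: measurable_bounded_integrable => //.
- exact: muitv.
- exact: measurable_funTS.
- have [M fM] := bf x y.
  exists M; split; first exact: num_real.
  by move=> N MN u /=; rewrite in_itv/= => /fM /le_trans; apply; exact: ltW.
Qed.

Lemma measurable_expRM b : measurable_fun setT (fun u : R => expR (b * u)).
Proof. by apply: measurableT_comp => //; exact: mulrl_measurable. Qed.

Lemma expRM_le b x y u : x <= u <= y -> expR (b * u) <= expR (`|b| * (`|x| + `|y|)).
Proof.
move=> /andP[xu uy]; rewrite ler_expR (le_trans (ler_norm _))// normrM ler_wpM2l//.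
rewrite ler_norml; have := ler_norm y; have := ler_norm (- x); rewrite normrN.
have := normr_ge0 x; have := normr_ge0 y; lra.
Qed.

Lemma locint_expRM b f : locint f -> locint (fun u => expR (b * u) * f u).
Proof.
move=> lf x y.
have := @integrableMr _ _ _ mu `[x, y]%classic _ (fun u => expR (b * u)) (EFin \o f).
apply=> //; last first.
  exists (expR (`|b| * (`|x| + `|y|))); split; first exact: num_real.
  move=> N MN u /=; rewrite in_itv/= => /(expRM_le b) /le_trans bu.
  by rewrite ger0_norm ?expR_ge0//; apply: bu; exact: ltW.
by apply: measurable_funTS; exact: measurable_expRM.
Qed.

Lemma locint_expR b : locint (fun u => expR (b * u)).
Proof.
apply: locint_bounded; first exact: measurable_expRM.
move=> x y; exists (expR (`|b| * (`|x| + `|y|))) => u xuy.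
by rewrite ger0_norm ?expR_ge0//; exact: expRM_le.
Qed.

Lemma density_expRM b f : density f -> density (fun u => expR (b * u) * f u).
Proof.
move=> [mf f0 lf]; split.
- by apply: measurable_funM => //; exact: measurable_expRM.
- by move=> u; rewrite mulr_ge0 ?expR_ge0.
- exact: locint_expRM.
Qed.

Lemma le_J_itv f x y y' : density f -> y <= y' -> J f x y <= J f x y'.
Proof.
move=> [_ f0 lf] yy'; have [xy|yx] := leP x y; last first.
  by rewrite (J_gt _ yx) J_ge0.
by rewrite (J_chasles lf xy yy') lerDl J_ge0.
Qed.

Lemma density_J f x : density f -> density (J f x).
Proof.
move=> df; have J0 u : 0 <= J f x u by case: df => _ f0 _; exact: J_ge0.
have mJ : measurable_fun setT (J f x).
  by apply: nondecreasing_measurable => // u v uv; exact: le_J_itv.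
split => //; apply: locint_bounded => // y z; exists (J f x z) => u /andP[_ uz].
by rewrite ger0_norm//; exact: le_J_itv.
Qed.


End local_integrals.

Section exponentials.
Context {R : realType}.
Implicit Types (f g : R -> R) (x y z b : R).
Local Notation mu := (@lebesgue_measure R).

Lemma is_derive_expRM b (u : R) :
  is_derive u 1 (fun v : R => expR (b * v)) (b * expR (b * u)).
Proof.
have h : is_derive u (1 : R) (fun v : R => b * v) b.
  by apply: is_derive_eq; rewrite /GRing.scale/= mulr1.
rewrite mulrC; exact: (@is_derive1_comp R expR (fun v => b * v) u _ _ (is_derive_expR _) h).
Qed.

Lemma continuous_expRM (b : R) : continuous (fun v : R => expR (b * v)).
Proof.
move=> u; apply/differentiable_continuous/derivable1_diffP.
by have [] := is_derive_expRM b u.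
Qed.

(** Keeping the factor [b] on the left avoids a division, so [b = 0] is covered too. *)
Lemma J_expR b x y : x <= y ->
  b * J (fun u => expR (b * u)) x y = expR (b * y) - expR (b * x).
Proof.
rewrite le_eqVlt => /predU1P[->|xy]; first by rewrite J_refl subrr mulr0.
rewrite -JZ; last exact: locint_expR.
have cE := @continuous_expRM b.
rewrite /J /Rintegral (@continuous_FTC2 _ _ (fun u => expR (b * u)))//=.
- apply: continuous_subspaceT => u.
  by apply: cvgM; [exact: cvg_cst|exact: cE].
- split.
  + by move=> u _; have [] := is_derive_expRM b u.
  + exact/cvg_at_right_filter/cE.
  + exact/cvg_at_left_filter/cE.
- by move=> u _; rewrite derive1E; have [_ ->] := is_derive_expRM b u.
Qed.

End exponentials.

(** * Reflections, translations and integration by parts *)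

Section reflection.
Context {R : realType} (d : R).
Local Notation mu := (@lebesgue_measure R).

Definition reflect (u : measurableTypeR R) : measurableTypeR R := d - u.

Lemma measurable_reflect : measurable_fun setT reflect.
Proof. exact: (@measurable_funB _ R R setT (cst d) id). Qed.

HB.instance Definition _ :=
  isMeasurableFun.Build _ _ (measurableTypeR R) (measurableTypeR R) reflect measurable_reflect.

Lemma preimage_reflect (b1 b2 : bool) (x y : R) :
  reflect @^-1` [set` Interval (BSide b1 x) (BSide b2 y)] =
  [set` Interval (BSide (~~ b2) (d - y)) (BSide (~~ b1) (d - x))].
Proof.
apply/seteqP; split => u; rewrite /reflect/= !in_itv/= !lteifBlDr; case: b1; case: b2 => /=; lra.
Qed.

(** Lebesgue measure is determined by its values on half-open intervals, and a reflection preserves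
    their length although it swaps which end is closed. *)
Lemma lebesgue_measure_reflect A : measurable A -> pushforward mu reflect A = mu A.
Proof.
move=> mA; apply/esym/lebesgue_measure_unique => //= _ [[a b]] _ <-.
rewrite /pushforward preimage_reflect/= !lebesgue_measure_itv/= !lte_fin.
have -> : (d - b < d - a) = (a < b) by lra.
by case: ifP => // _; congr EFin; lra.
Qed.

Lemma J_reflect f (x y : R) : density f ->
  J f x y = J (fun u => f (d - u)) (d - y) (d - x).
Proof.
move=> [mf f0 _]; rewrite /J /Rintegral; congr fine.
have -> : `[d - y, d - x]%classic = reflect @^-1` `[x, y].
  by rewrite preimage_reflect.
rewrite -(@ge0_integral_pushforward _ _ _ _ _ reflect measurable_reflect mu `[x, y]%classic (EFin \o f))//.
- by apply: eq_measure_integral => //= A mA AS; exact/esym/lebesgue_measure_reflect.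
- by apply/measurable_EFinP; exact: measurable_funTS.
- by move=> u _; rewrite lee_fin.
Qed.

End reflection.

Section parts.
Context {R : realType}.
Implicit Types (f g : R -> R) (x y z b : R).
Local Notation mu := (@lebesgue_measure R).

Lemma density_reflect (d : R) f : density f -> density (fun u => f (d - u)).
Proof.
move=> [mf f0 lf].
have mfd : measurable_fun setT (fun u : R => f (d - u)).
  by apply: measurableT_comp => //; exact: (@measurable_reflect R d).
split => // x y; apply/integrableP; split.
  by apply/measurable_EFinP; exact: measurable_funTS.
have /integrableP[_] := lf (d - y) (d - x).
congr (_ < _)%E.
have -> : `[x, y]%classic = reflect d @^-1` `[d - y, d - x].
  by rewrite preimage_reflect/= !(opprB, addrC d) !subrK.
rewrite -(@ge0_integral_pushforward _ _ _ _ _ (reflect d) (@measurable_reflect R d) mu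
  `[d - y, d - x]%classic (fun u => `|(f u)%:E|)%E)//.
- by apply: eq_measure_integral => //= A mA AS; exact/esym/lebesgue_measure_reflect.
- by apply/measurable_EFinP; apply: measurableT_comp => //; exact: measurable_funTS.
Qed.

(** A translation is the composite of two reflections. *)
Lemma J_shift (d : R) f x y : density f ->
  J f x y = J (fun u => f (u + d)) (x - d) (y - d).
Proof.
move=> df; rewrite (J_reflect 0 f x y df) (J_reflect (- d) _ _ _ (density_reflect 0 f df)).
rewrite !sub0r !opprK ![- d + _]addrC.
by apply: eq_J => u _; congr f; ring.
Qed.

Lemma density_shift (d : R) f : density f -> density (fun u => f (u + d)).
Proof.
move=> df; have := density_reflect (- d) _ (density_reflect 0 f df).
by congr density; apply/funext => u; congr f; lra.
Qed.

Lemma ge0_integral_itv_indic f x y :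
  (\int[mu]_s ((x <= s <= y)%R%:R * f s)%:E = \int[mu]_(s in `[x, y]) (f s)%:E)%E.
Proof.
rewrite [RHS]integral_mkcond; apply: eq_integral => s _.
rewrite patchE; have [|] := boolP (s \in `[x, y]%classic).
  by rewrite inE/= in_itv/= => ->; rewrite mul1r.
by rewrite notin_setE/= in_itv/= => /negP/negbTE ->; rewrite mul0r.
Qed.

(** Integration by parts without differentiating the primitive of [f]: integrate b e^{-bu} f(s) over
    the triangle x <= s <= u <= y in both orders. For fixed s, the integral over u in [s, y] is
    e^{-bs} - e^{-by}. *)
Lemma J_exp_parts f b x y : density f -> 0 < b ->
  b * J (fun u => expR (- b * u) * J f x u) x y =
  J (fun s => expR (- b * s) * f s - expR (- b * y) * f s) x y.
Proof.
move=> df b0; have [mf f0 lf] := df.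
pose k (u : R) : R := (x <= u <= y)%R%:R * (b * expR (- b * u)).
pose g (p : R * R) : R := k p.1 * ((x <= p.2 <= p.1)%R%:R * f p.2).
have k0 u : 0 <= k u by rewrite /k !mulr_ge0 ?expR_ge0// ltW.
have mbool (disp : measure_display) (T : measurableType disp) (B : T -> bool) : measurable_fun setT B ->
    measurable_fun setT (fun t => (B t)%:R : R).
  move=> mB; apply: (@eq_measurable_fun _ _ _ _ _ (fun t => if B t then (1 : R) else 0)).
    by move=> t _; case: (B t).
  exact: measurable_fun_ifT.
have mg : measurable_fun setT (EFin \o g).
  apply/measurable_EFinP; rewrite /g /k; apply: measurable_funM.
    apply: (@measurableT_comp _ _ _ _ _ _ (fun u => (x <= u <= y)%R%:R * (b * expR (- b * u)))) => //.
    apply: measurable_funM.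
      by apply: mbool; apply: measurable_and; apply: measurable_fun_ler.
    by apply: measurable_funM => //; exact: measurable_expRM.
  apply: measurable_funM; last exact: measurableT_comp.
  by apply: mbool; apply: measurable_and; apply: measurable_fun_ler.
have g0 p : (0 <= (EFin \o g) p)%E.
  by rewrite /= lee_fin /g mulr_ge0// mulr_ge0.
have := @fubini_tonelli _ _ _ _ R mu mu (EFin \o g) mg g0.
have -> : (\int[mu]_u \int[mu]_s (EFin \o g) (u, s) =
    (b * J (fun u => expR (- b * u) * J f x u) x y)%:E)%E.
  have lJ := density_expRM (- b) (density_J x df).
  rewrite -JZ; last by case: lJ.
  rewrite EFin_J; last by apply: locintZ; case: lJ.
  rewrite -ge0_integral_itv_indic; apply: eq_integral => u _.
  under eq_integral do rewrite /= /g/= EFinM.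
  rewrite ge0_integralZl_EFin//.
  - by rewrite ge0_integral_itv_indic -EFin_J// -EFinM /k; congr EFin; ring.
  - by move=> s _; rewrite lee_fin mulr_ge0.
  - apply/measurable_EFinP; apply: measurable_funM => //.
    by apply: mbool; apply: measurable_and; apply: measurable_fun_ler.
have -> : (\int[mu]_s \int[mu]_u (EFin \o g) (u, s) =
    (J (fun s => expR (- b * s) * f s - expR (- b * y) * f s) x y)%:E)%E.
  rewrite EFin_J; last first.
    by apply: locintB; [exact: locint_expRM|exact: locintZ].
  rewrite -ge0_integral_itv_indic; apply: eq_integral => s _.
  have -> : (fun u => (EFin \o g) (u, s)) =
      (fun u => ((x <= s <= y)%R%:R * b * f s)%:E * ((s <= u <= y)%R%:R * expR (- b * u))%:E)%E.
    apply/funext => u; rewrite /= -EFinM /g /k/=; congr EFin.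
    (* Both products of indicators describe the same triangle; the form on the right frees the outer
       condition on s from u. *)
    have [xs|xs] := leP x s; have [su|su] := leP s u; have [uy|uy] := leP u y;
      rewrite ?andbT ?andbF/= ?(mulr0, mul0r)//.
    have -> : x <= u by lra.
    have -> : s <= y by lra.
    by rewrite /=; ring.
  rewrite ge0_integralZl_EFin//.
  - rewrite (ge0_integral_itv_indic (fun u => expR (- b * u))) -(@EFin_J R (fun u => expR (- b * u)) s y (locint_expR (- b))).
    rewrite -EFinM; congr EFin; case: (boolP (x <= s <= y)) => [/andP[xs sy]|_].
      have := J_expR (- b) s y sy => /(congr1 (fun v => - f s * v)) h.
      by move: h; rewrite /=; lra.
    by rewrite !mul0r.
  - apply/measurable_EFinP; apply: measurable_funM; last exact: measurable_expRM.
    by apply: mbool; apply: measurable_and; apply: measurable_fun_ler.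
  - by rewrite !mulr_ge0// ltW.
by move=> h; apply: EFin_inj; exact: h.
Qed.

End parts.
(** * Wealth along a consumption path *)

Section dynamics.
Local Set Implicit Arguments.
Local Unset Strict Implicit.
Context {R : realType}.
Variables (a eps eta tau : R).
Hypotheses (a_gt0 : 0 < a) (eta_gt0 : 0 < eta) (tau_gt0 : 0 < tau) (eps_gt0 : 0 < eps).
Implicit Types (f : R -> R) (t u x y k : R).

Let beta := a + eta.
Let beta_gt0 : 0 < beta. Proof. exact: addr_gt0. Qed.

Definition stock f t := eps * (expR (- eta * t) * J (fun u => expR (eta * u) * f u) (t - tau) t).

Definition spending f x y := J (fun u => expR (- a * u) * f u) x y.

(** Closed form of 1 - eps int_{-tau}^0 e^{beta s} ds: a unit of capital, less the present value of
    the habit that it finances. *)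
Definition kappa := 1 - eps * (1 - expR (- beta * tau)) / beta.

(* [wealth] is the right-hand side of the closed-loop policy, discounted to time 0;
   at t = 0 it is the functional G of the initial state. *)
Definition wealth k0 f t :=
  kappa * (k0 - spending f 0 t) - expR (- a * t) * stock f t / beta
  + eps * expR (- beta * tau) / beta * spending f (t - tau) t.

Lemma spendingD f x y z : density f -> x <= y -> y <= z ->
  spending f x z = spending f x y + spending f y z.
Proof. by move=> [_ _ lf]; apply: J_chasles; exact: locint_expRM. Qed.

Lemma spending_ge0 f x y : density f -> 0 <= spending f x y.
Proof. by move=> [_ f0 _]; apply: J_ge0 => u _; rewrite mulr_ge0 ?expR_ge0. Qed.

Let P f u := J (fun s => expR (eta * s) * f s) (- tau) u.

Lemma stockE f t : density f -> 0 <= t ->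
  stock f t = eps * (expR (- eta * t) * (P f t - P f (t - tau))).
Proof.
move=> [_ _ lf] t0; have lp := locint_expRM eta lf.
rewrite /stock /P (@J_chasles _ _ (- tau) (t - tau) t)//; first by congr (_ * (_ * _)); ring.
  by rewrite lerBrDl addrN.
by rewrite gerBl ltW.
Qed.

Lemma density_P f : density f -> density (P f).
Proof. by move=> df; apply: density_J; exact: density_expRM. Qed.

(** The weight e^{-beta s} meets the density e^{eta s} f(s) of [P f], and their product e^{-as} f(s)
    is discounted consumption. *)
Lemma P_parts f y : density f -> - tau <= y ->
  beta * J (fun u => expR (- beta * u) * P f u) (- tau) y =
  spending f (- tau) y - expR (- beta * y) * P f y.
Proof.
move=> df y0; have dp := density_expRM eta df.
have lp : locint (fun u => expR (eta * u) * f u) by case: dp.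
rewrite J_exp_parts// JB; [|exact: locint_expRM|exact: locintZ].
rewrite JZ//; congr (_ - _); apply: eq_J => s _.
by rewrite mulrA -expRD; congr (expR _ * _); rewrite /beta; ring.
Qed.

Lemma locint_stock f : density f -> locint (fun u => expR (- beta * u) * P f (u - tau)).
Proof.
by move=> df; have [_ _ l] := density_shift (- tau) _ (density_P df); exact: locint_expRM.
Qed.

(** The discounted habit is a difference of [P f] at u and at u - tau, weighted by e^{-beta u}.
    [P_parts] at 0 and t handles the first term; for the second, shift by tau and use it at t -
    tau. *)
Lemma spending_stock f t : density f -> 0 <= t ->
  beta * spending (stock f) 0 t =
  eps * (spending f 0 t - expR (- beta * tau) * spending f (- tau) (t - tau))
  - expR (- a * t) * stock f t + stock f 0.
Proof.
move=> df t0.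
have lP : locint (fun u => expR (- beta * u) * P f u) by case: (density_expRM (- beta) (density_P df)).
have lS := locint_stock df.
have -> : spending (stock f) 0 t =
    eps * (J (fun u => expR (- beta * u) * P f u) 0 t
           - J (fun u => expR (- beta * u) * P f (u - tau)) 0 t).
  rewrite -JB// -JZ; last exact: locintB.
  apply: eq_J => u /andP[u0 _]; rewrite (stockE df u0).
  have -> : expR (- beta * u) = expR (- a * u) * expR (- eta * u).
    by rewrite -expRD; congr expR; rewrite /beta; ring.
  by ring.
have tau0 : - tau <= 0 by rewrite oppr_le0 ltW.
have := J_chasles lP tau0 t0.
have := P_parts df tau0; have := @P_parts f t df (le_trans tau0 t0).
have tt : - tau <= t - tau by rewrite lerBrDl addrN.
have := P_parts df tt.
rewrite (J_shift (- tau) _ (- tau) (t - tau)); last exact/density_expRM/density_P.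
rewrite opprK addNr subrK.
have -> : J (fun u => expR (- beta * (u - tau)) * P f (u - tau)) 0 t =
    expR (beta * tau) * J (fun u => expR (- beta * u) * P f (u - tau)) 0 t.
  rewrite -JZ//; apply: eq_J => u _; rewrite mulrA -expRD; congr (expR _ * _); ring.
rewrite (spendingD df tau0 t0) (stockE df t0) (stockE df (lexx 0)).
have -> : expR (- beta * (t - tau)) = expR (- beta * t) * expR (beta * tau).
  by rewrite -expRD; congr expR; ring.
have -> : expR (- beta * t) = expR (- a * t) * expR (- eta * t).
  by rewrite -expRD; congr expR; rewrite /beta; ring.
rewrite !mulr0 expR0 sub0r.
have -> : P f (- tau) = 0 by rewrite /P J_refl.
have : expR (- beta * tau) * expR (beta * tau) = 1.
  by rewrite -expRD -[RHS]expR0; congr expR; ring.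
set X2 := J _ 0 t; set X1 := J _ 0 t; set X3 := J _ _ 0; set X4 := J _ _ t.
set E1 := expR _; set E2 := expR _; set E3 := expR _; set E4 := expR _.
set S1 := spending f 0 t; set S2 := spending f (- tau) (t - tau).
set S3 := spending f (- tau) 0; set p1 := P f t; set p2 := P f (t - tau); set p3 := P f 0.
clearbody X1 X2 X3 X4 E1 E2 E3 E4 S1 S2 S3 p1 p2 p3 => e1 h1 h2 h3 h4.
(* The exponentials are now opaque for [ring], so the relation [E1 * E2 = 1] has to be inserted by
   hand. *)
have h1' : beta * X2 = E1 * (S2 - E3 * E4 * E2 * p2).
  by rewrite -h1; transitivity (E1 * E2 * (beta * X2)); [rewrite e1 mul1r|ring].
have h1'' : E1 * (E3 * E4 * E2 * p2) = E3 * E4 * p2.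
  by transitivity (E1 * E2 * (E3 * E4 * p2)); [ring|rewrite e1 mul1r].
have h5 : beta * X1 = S1 - E3 * E4 * p1 + p3.
  have -> : X1 = X4 - X3 by lra.
  by rewrite mulrBr h2 h3; ring.
transitivity (eps * (beta * X1 - beta * X2)); first by ring.
by rewrite h5 h1' (mulrBr E1) h1''; ring.
Qed.

(** By [spending_stock], the discounted habit brings in spending over [-tau, t - tau]; the last term
    of [wealth] supplies the window [t - tau, t]. Together they give spending over [-tau, t], whose
    part before 0 is constant and whose part after 0 is absorbed by [kappa]. *)
Lemma wealth_dynamics k0 f t : density f -> locint (stock f) -> 0 <= t ->
  wealth k0 f t = wealth k0 f 0 - J (fun u => expR (- a * u) * (f u - stock f u)) 0 t.
Proof.
move=> df ls t0; have [_ _ lf] := df.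
have -> : J (fun u => expR (- a * u) * (f u - stock f u)) 0 t =
    spending f 0 t - spending (stock f) 0 t.
  rewrite /spending -JB; [|exact: locint_expRM..].
  by apply: eq_J => u _; rewrite mulrBr.
have tau0 : - tau <= 0 by rewrite oppr_le0 ltW.
have tt : - tau <= t - tau by rewrite lerBrDl addrN.
have tt' : t - tau <= t by rewrite gerBl ltW.
have := spending_stock df t0.
have := spendingD df tau0 t0; rewrite (spendingD df tt tt').
have s00 : spending f 0 0 = 0 by rewrite /spending J_refl.
rewrite /wealth /kappa mulr0 expR0 s00 sub0r => h1 /(congr1 (fun v => v / beta)).
rewrite mulrC mulKf ?gt_eqF// => ->.
have -> : spending f (t - tau) t =
  spending f (- tau) 0 + spending f 0 t - spending f (- tau) (t - tau) by lra.
by field; rewrite gt_eqF.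
Qed.

End dynamics.
Section almost_everywhere.
Context {R : realType}.
Local Notation mu := (@lebesgue_measure R).

Lemma ae_imp {P Q : R -> Prop} : (forall t, P t -> Q t) ->
  {ae mu, forall t, P t} -> {ae mu, forall t, Q t}.
Proof. exact: (@filterS _ _ (ae_filter_ringOfSetsType mu)). Qed.

Lemma ae_imp2 {P Q S : R -> Prop} : (forall t, P t -> Q t -> S t) ->
  {ae mu, forall t, P t} -> {ae mu, forall t, Q t} -> {ae mu, forall t, S t}.
Proof. exact: (@filterS2 _ _ (ae_filter_ringOfSetsType mu)). Qed.

End almost_everywhere.

(** * Uniqueness and existence for the habit equation *)

Section gronwall.
Local Set Implicit Arguments.
Local Unset Strict Implicit.
Context {R : realType}.
Implicit Types (f g : R -> R) (x y z b : R).
Local Notation mu := (@lebesgue_measure R).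

Lemma le_J_ae f g x y : density f -> density g ->
  {ae mu, forall u, x <= u -> f u <= g u} -> J f x y <= J g x y.
Proof.
move=> [mf f0 lf] [mg g0 lg] fg; rewrite -lee_fin !EFin_J//.
apply: ae_ge0_le_integral => //.
- by move=> u _; rewrite lee_fin.
- by apply/measurable_EFinP; exact: measurable_funTS.
- by move=> u _; rewrite lee_fin.
- by apply/measurable_EFinP; exact: measurable_funTS.
- by apply: ae_imp fg => u fgu; rewrite /= in_itv/= => /andP[xu _]; rewrite lee_fin fgu.
Qed.

Lemma densityZ k f : 0 <= k -> density f -> density (fun u => k * f u).
Proof.
move=> k0 [mf f0 lf]; split; first exact: measurable_funM.
  by move=> u; rewrite mulr_ge0.
exact: locintZ.
Qed.

Lemma gronwall f x K : density f -> 0 < K ->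
  {ae mu, forall t : R, x <= t -> f t <= K * J f x t} -> forall y, J f x y = 0.
Proof.
move=> df K0 fK y; have [mf f0 lf] := df.
have [yx|xy] := ltP y x; first by rewrite J_gt.
(* With the weight e^{-2Kt} the Volterra operator is a contraction of ratio 1/2. *)
pose L := 2 * K; have L0 : 0 < L by rewrite mulr_gt0.
have [_ _ lE] := density_expRM (- L) df.
have dJ := density_expRM (- L) (density_J x df).
have Q0 : J (fun s => expR (- L * s) * f s) x y <= 0.
  have h1 : J (fun s => expR (- L * s) * f s) x y <=
      K * J (fun u => expR (- L * u) * J f x u) x y.
    rewrite -JZ; last by case: dJ.
    apply: le_J_ae; [exact: density_expRM|by apply: densityZ => //; exact: ltW|].
    apply: ae_imp fK => u fu xu; rewrite mulrCA ler_wpM2l ?expR_ge0//; exact: fu.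
  have := J_exp_parts f L x y df L0.
  rewrite JB//; last exact: locintZ.
  rewrite JZ// => h2.
  have h3 : 0 <= expR (- L * y) * J f x y by rewrite mulr_ge0 ?expR_ge0// J_ge0.
  move: h1 h2; rewrite /L; lra.
apply/eqP; rewrite eq_le J_ge0// andbT.
have : J f x y <= expR (L * y) * J (fun s => expR (- L * s) * f s) x y.
  rewrite -JZ//; apply: le_J => //; first exact: locintZ.
  move=> u /andP[_ uy]; rewrite mulrA ler_peMl// -expRD -[leLHS]expR0 ler_expR.
  by rewrite mulNr -mulrBr mulr_ge0 ?subr_ge0// ltW.
by move/le_trans; apply; rewrite pmulr_rle0 ?expR_gt0.
Qed.

Lemma J_eq0_ae f x : density f -> (forall y, J f x y = 0) ->
  {ae mu, forall t, x <= t -> f t = 0}.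
Proof.
move=> [mf f0 lf] Jf.
have /ae_foralln : forall n : nat, {ae mu, forall t, `[x, x + n%:R]%classic t -> (f t)%:E = 0%E}.
  move=> n; set z := x + n%:R.
  have : (\int[mu]_(t in `[x, z]) `|(f t)%:E| = 0)%E.
    under eq_integral do rewrite gee0_abs ?lee_fin//.
    by rewrite -EFin_J// Jf.
  by move/ae_eq_integral_abs; apply => //; apply/measurable_EFinP; exact: measurable_funTS.
apply: ae_imp => t ft xt.
have [n tn] : exists n : nat, t <= x + n%:R.
  exists (Num.bound (t - x)); rewrite -lerBlDl ltW//.
  by rewrite archi_boundP// subr_ge0.
by apply: EFin_inj; apply: (ft n); rewrite /= in_itv/= xt.
Qed.

End gronwall.

Section uniqueness.
Local Set Implicit Arguments.
Local Unset Strict Implicit.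
Context {R : realType}.
Variables (eps eta tau : R).
Hypotheses (eta_gt0 : 0 < eta) (tau_gt0 : 0 < tau) (eps_gt0 : 0 < eps).
Implicit Types (f g : R -> R) (t u : R).
Local Notation mu := (@lebesgue_measure R).
Local Notation h := (stock eps eta tau).

Lemma density_dist f g : density f -> density g -> density (fun u => `|f u - g u|).
Proof.
move=> [mf _ lf] [mg _ lg]; split => //.
  by apply: measurableT_comp => //; exact: measurable_funB.
by apply: locint_norm; exact: locintB.
Qed.

(** The weights e^{eta (u - t)} are at most 1 on the window, which is then enlarged to [-tau, t] to
    reach the form required by [gronwall]. *)
Lemma stock_dist f g t : density f -> density g -> 0 <= t ->
  `|h f t - h g t| <= eps * J (fun u => `|f u - g u|) (- tau) t.
Proof.
move=> df dg t0; have [_ _ lf] := df; have [_ _ lg] := dg.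
have dd := density_dist df dg; have [_ _ ld] := dd.
rewrite /stock -mulrBr -mulrBr normrM gtr0_norm// ler_wpM2l ?(ltW eps_gt0)//.
rewrite -JB; [|exact: locint_expRM..].
rewrite normrM gtr0_norm ?expR_gt0//.
have tt : - tau <= t - tau by rewrite lerBrDl addrN.
have tt' : t - tau <= t by rewrite gerBl ltW.
have lB : locint (fun u => expR (eta * u) * f u - expR (eta * u) * g u).
  by apply: locintB; exact: locint_expRM.
apply: (@le_trans _ _ (J (fun u => `|f u - g u|) (t - tau) t)); last first.
  by rewrite (J_chasles ld tt tt') lerDr J_ge0.
apply: (@le_trans _ _ (expR (- eta * t) * J (fun u => expR (eta * t) * `|f u - g u|) (t - tau) t)).
  rewrite ler_wpM2l ?expR_ge0// (le_trans (normr_J _ _ lB))//.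
  apply: le_J; [exact: locint_norm|exact: locintZ|].
  move=> u /andP[_ ut]; rewrite -mulrBr normrM gtr0_norm ?expR_gt0//.
  by rewrite ler_wpM2r// ler_expR ler_pM2l.
by rewrite JZ// mulrA -expRD mulNr addNr expR0 mul1r.
Qed.

(** Equal surpluses make f - g equal to the difference of the habits, so [gronwall] applies to |f -
    g|. The habit sees only integrals, hence agrees at every t >= 0. *)
Lemma stock_unique f g : density f -> density g ->
  (forall u, u < 0 -> f u = g u) ->
  {ae mu, forall t, 0 <= t -> f t - h f t = g t - h g t} ->
  (forall t, 0 <= t -> h f t = h g t) /\
  {ae mu, forall t, 0 <= t -> f t = g t}.
Proof.
move=> df dg fg0 fg; have dd := density_dist df dg.
have J0 : forall y, J (fun u => `|f u - g u|) (- tau) y = 0.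
  apply: (gronwall dd eps_gt0); apply: ae_imp fg => t fgt _.
  have [t0|t0] := ltP t 0.
    by rewrite fg0// subrr normr0 mulr_ge0 ?(ltW eps_gt0)// J_ge0.
  rewrite (le_trans _ (stock_dist df dg t0))// (_ : f t - g t = h f t - h g t)//.
  by have := fgt t0; lra.
split=> [t t0|].
  have := stock_dist df dg t0; rewrite J0 mulr0 normr_le0 subr_eq0.
  by move/eqP.
have := J_eq0_ae dd J0; apply: ae_imp => t ft t0; apply/eqP.
rewrite -subr_eq0 -normr_eq0; apply/eqP/ft.
by rewrite (le_trans _ t0)// oppr_le0 ltW.
Qed.

End uniqueness.
Section existence.
Local Set Implicit Arguments.
Local Unset Strict Implicit.
Context {R : realType}.
Implicit Types (f g : R -> R) (t u x y : R).
Local Notation mu := (@lebesgue_measure R).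

Lemma density_le f g : measurable_fun setT f -> (forall u, 0 <= f u) -> density g ->
  (forall u, f u <= g u) -> density f.
Proof.
move=> mf f0 [mg g0 lg] fg; split => // x y.
apply: le_integrable (lg x y) => //.
- by apply/measurable_EFinP; exact: measurable_funTS.
- by move=> u _; rewrite /= lee_fin !ger0_norm.
Qed.

Lemma cvg_J (fn : nat -> R -> R) f x y : (forall n, density (fn n)) -> density f ->
  (forall u, nondecreasing_seq (fn ^~ u)) -> (forall u, fn ^~ u @ \oo --> f u) ->
  (fun n => J (fn n) x y) @ \oo --> J f x y.
Proof.
move=> dfn df nd fnf; have [_ _ lf] := df.
have h : (J (fn n) x y)%:E @[n --> \oo] --> (J f x y)%:E.
  rewrite EFin_J//.
  have -> : (fun n => (J (fn n) x y)%:E) =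
      (fun n => \int[mu]_(u in `[x, y]) (fn n u)%:E)%E.
    by apply/funext => n; rewrite EFin_J//; case: (dfn n).
  have -> : (\int[mu]_(u in `[x, y]) (f u)%:E =
      \int[mu]_(u in `[x, y]) limn (fun n => (fn n u)%:E))%E.
    apply: eq_integral => u _; apply/esym/cvg_lim => //.
    by apply: cvg_EFin; [exact: nearW|exact: fnf].
  apply: cvg_monotone_convergence => //.
  - move=> n; apply/measurable_EFinP; apply: measurable_funTS.
    by case: (dfn n).
  - by move=> n u _; rewrite lee_fin; case: (dfn n).
  - by move=> u _ m n mn; rewrite lee_fin; exact: nd.
exact: (fine_cvg h).
Qed.

Variables (eps eta tau : R).
Hypotheses (eta_gt0 : 0 < eta) (tau_gt0 : 0 < tau) (eps_gt0 : 0 < eps).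
Local Notation h := (stock eps eta tau).

Lemma le_stock f g t : density f -> density g -> (forall u, f u <= g u) -> h f t <= h g t.
Proof.
move=> [_ _ lf] [_ _ lg] fg; rewrite /stock ler_pM2l// ler_pM2l ?expR_gt0//.
by apply: le_J; [exact: locint_expRM..|move=> u _; rewrite ler_pM2l ?expR_gt0].
Qed.

Lemma stock_le_J f t : density f -> 0 <= t -> h f t <= eps * J f (- tau) t.
Proof.
move=> df t0; have d0 : density (fun=> 0 : R).
  split => //; apply: locint_bounded => // x y.
  by exists 0 => u _; rewrite normr0.
have := stock_dist eta_gt0 tau_gt0 eps_gt0 df d0 t0.
have -> : h (fun=> 0) t = 0.
  rewrite /stock (_ : (fun u => _) = (fun=> 0)); last by apply/funext => u; rewrite mulr0.
  by rewrite /J /Rintegral integral0 !mulr0.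
rewrite subr0 (_ : (fun u => `|_|) = f).
  exact/le_trans/ler_norm.
by apply/funext => u; rewrite subr0 ger0_norm//; case: df.
Qed.

(* Agrees with [stock] for t >= 0, but is visibly measurable on the whole line. *)
Definition stock_from f t :=
  let P u := J (fun s => expR (eta * s) * f s) (- tau) u in
  eps * (expR (- eta * t) * (P t - P (t - tau))).

Lemma density_stock_from f : density f -> density (stock_from f).
Proof.
move=> df; have dp := density_expRM eta df.
have dP := density_J (- tau) dp; have dPs := density_shift (- tau) _ dP.
rewrite /stock_from; apply: densityZ; first exact: ltW.
apply: density_expRM; apply: (density_le _ _ dP).
- by case: dP => ? _ _; case: dPs => ? _ _; exact: measurable_funB.
- by move=> u; rewrite subr_ge0 le_J_itv// gerBl ltW.
- by move=> u; rewrite gerBl; case: dPs.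
Qed.

Lemma stock_fromE f t : density f -> 0 <= t -> h f t = stock_from f t.
Proof. exact: stockE. Qed.

Variables (past z : R -> R) (C L : R).
Hypotheses (dpast : density past) (past0 : forall u, 0 <= u -> past u = 0)
  (mz : measurable_fun setT z) (z0 : forall u, 0 <= z u)
  (zC : forall u, 0 <= u -> z u <= C * expR (L * u)) (C0 : 0 <= C) (L0 : 2 * eps <= L).

Let Phi f t := if t < 0 then past t else z t + stock_from f t.
(* m is a supersolution: Phi maps { f <= m } into itself, so the increasing
   iteration started at the past converges. *)
Let M := 2 * (C + eps * J past (- tau) 0).
Let m u := past u + M * expR (L * u).

Let M0 : 0 <= M.
Proof.
rewrite /M mulr_ge0// addr_ge0// mulr_ge0 ?(ltW eps_gt0)// J_ge0// => u _.
by case: dpast.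
Qed.

Let dm : density m.
Proof.
have [mp p0 lp] := dpast; split.
- by apply: measurable_funD => //; apply: measurable_funM => //; exact: measurable_expRM.
- by move=> u; rewrite addr_ge0// mulr_ge0 ?expR_ge0.
- by apply: locintD => //; apply: locintZ; exact: locint_expR.
Qed.

(** Origin of the constants: L >= 2 eps makes eps int e^{Ls} at most e^{Lu} / 2, so the habit
    generated by M e^{Lu} uses at most half of it. The other half, C + eps int past, covers the
    surplus and the inherited consumption. *)
Let Phi_le f : density f -> (forall u, f u <= m u) -> forall u, Phi f u <= m u.
Proof.
move=> df fm u; rewrite /Phi; case: ltP => u0.
  by rewrite lerDl mulr_ge0 ?expR_ge0.
rewrite -stock_fromE// /m past0// add0r.
have [_ _ lp] := dpast.
have lE := locint_expR (R := R) L.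
have L_gt0 : 0 < L by rewrite (lt_le_trans _ L0)// mulr_gt0.
have tau0 : - tau <= 0 by rewrite oppr_le0 ltW.
have h1 : h f u <= eps * (J past (- tau) 0 + M * J (fun s => expR (L * s)) (- tau) u).
  apply: (le_trans (stock_le_J df u0)); rewrite ler_pM2l//.
  have -> : J past (- tau) 0 = J past (- tau) u.
    rewrite (J_chasles lp tau0 u0) (@eq_J _ (fun=> 0) past 0 u).
      by rewrite /J [X in _ + X]/Rintegral integral0 addr0.
    by move=> s /andP[s0 _]; exact: past0.
  rewrite -JZ// -JD//; last exact: locintZ.
  by apply: le_J; [case: df|case: dm|move=> s _; exact: fm].
have := J_expR L (- tau) u (le_trans tau0 u0).
have e0 : 0 <= expR (L * - tau) by exact: expR_ge0.
have e1 : 1 <= expR (L * u) by rewrite -expR0 ler_expR mulr_ge0// ltW.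
set JE := J _ (- tau) u in h1 *; set E := expR (L * u) in e1 *; move=> JEE.
have JE0 : 0 <= JE by apply: J_ge0 => s _; exact: expR_ge0.
have h2 : 2 * eps * JE <= E.
  by apply: (@le_trans _ _ (L * JE)); [rewrite ler_wpM2r|lra].
have Q0 : 0 <= eps * J past (- tau) 0.
  by rewrite mulr_ge0 ?(ltW eps_gt0)// J_ge0// => s _; case: dpast.
have h3 : eps * J past (- tau) 0 <= eps * J past (- tau) 0 * E by rewrite ler_peMr.
have h4 : M * (2 * eps * JE) <= M * E by rewrite ler_wpM2l.
have := zC u0; move: h1 h4; rewrite -/E /M; move: h3.
set q := eps * J _ _ _; rewrite mulrDr -/q => h3 h1 h4 h5.
nra.
Qed.

Let density_Phi f : density f -> (forall u, f u <= m u) -> density (Phi f).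
Proof.
move=> df fm; have [mp p0 _] := dpast; have [ms s0 _] := density_stock_from df.
apply: (density_le _ _ dm); last exact: Phi_le.
- apply: measurable_fun_ifT => //; first exact: measurable_fun_ltr.
  exact: measurable_funD.
- by move=> u; rewrite /Phi; case: ifP => // _; rewrite addr_ge0.
Qed.

Let fn n := iter n Phi past.

Let fn_density n : density (fn n) /\ forall u, fn n u <= m u.
Proof.
elim: n => [|n [dn mn]].
  by split => // u; rewrite /m lerDl mulr_ge0 ?expR_ge0.
by split; [exact: density_Phi|exact: Phi_le].
Qed.

Let le_Phi f g : density f -> density g -> (forall u, f u <= g u) ->
  forall u, Phi f u <= Phi g u.
Proof.
move=> df dg fg u; rewrite /Phi; case: ltP => // u0; rewrite lerD2l.
by rewrite -!stock_fromE//; exact: le_stock.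
Qed.

Let fn_nd u : nondecreasing_seq (fn ^~ u).
Proof.
apply/nondecreasing_seqP => n; elim: n u => [|n IH] u.
  rewrite /fn/= /Phi; case: ltP => // u0; rewrite past0//.
  by have [_ s0 _] := density_stock_from dpast; rewrite addr_ge0.
have [d1 _] := fn_density n; have [d2 _] := fn_density n.+1.
exact: (le_Phi d1 d2 IH).
Qed.

Let f u := limn (fn ^~ u).

Let fn_cvg u : fn ^~ u @ \oo --> f u.
Proof.
suff : cvgn (fn ^~ u) by [].
apply: nondecreasing_is_cvgn; first exact: fn_nd.
by exists (m u) => _ [n _ <-]; case: (fn_density n).
Qed.

Let df : density f.
Proof.
apply: (density_le _ _ dm).
- apply: (@measurable_fun_cvg _ _ _ setT fn) => [n|u _]; last exact: fn_cvg.
  by case: (fn_density n) => -[].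
- move=> u; apply: limr_ge; first by apply/cvg_ex; exists (f u); exact: fn_cvg.
  by apply: nearW => n; case: (fn_density n) => -[].
- move=> u; apply: limr_le; first by apply/cvg_ex; exists (f u); exact: fn_cvg.
  by apply: nearW => n; case: (fn_density n).
Qed.

(** The iterates increase pointwise below [m], so monotone convergence passes to the limit inside
    the habit. The equation then holds at every t >= 0, as the policy demands. *)
Lemma stock_fixpoint : exists g, [/\ density g, (forall u, u < 0 -> g u = past u) &
  forall t, 0 <= t -> g t = z t + h g t].
Proof.
exists f; split => // [u u0|t t0].
  apply/cvg_lim => //; apply: (@cvg_trans _ (past u @[_ --> \oo])); last exact: cvg_cst.
  apply: near_eq_cvg; apply: nearW => -[//|n]; by rewrite /fn/= /Phi u0.
have h1 : (fun n => fn n.+1 t) @ \oo --> f t.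
  by rewrite (cvg_shiftS (fn ^~ t)); exact: fn_cvg.
suff h2 : (fun n => fn n.+1 t) @ \oo --> z t + h f t.
  by rewrite -(cvg_lim _ h1)// (cvg_lim _ h2).
have -> : (fun n => fn n.+1 t) = (fun n => z t + h (fn n) t).
  apply/funext => n; rewrite /fn/= -/(fn n) /Phi ltNge t0/=.
  by rewrite stock_fromE//; case: (fn_density n).
apply: cvgD; first exact: cvg_cst.
apply: cvgMr; apply: cvgMr; apply: cvg_J.
- by move=> n; apply: density_expRM; case: (fn_density n).
- exact: density_expRM.
- by move=> u n n' nn'; rewrite ler_pM2l ?expR_gt0//; exact: fn_nd.
- by move=> u; apply: cvgMr; exact: fn_cvg.
Qed.

End existence.
(** * Power utility *)

Section utility.
Local Set Implicit Arguments.
Local Unset Strict Implicit.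
Context {R : realType}.
Implicit Types (s w x y gam : R).

(* e^w - e^{sw}/s has derivative e^{sw} (e^{(1-s)w} - 1), of the sign of w. *)
Lemma expR_chord s w : s < 1 -> s != 0 -> w != 0 ->
  (expR (s * w) - 1) / s < expR w - 1.
Proof.
move=> s1 s0 w0.
pose F v : R := expR (1 * v) - s^-1 * expR (s * v).
pose dF v : R := 1 * expR (1 * v) - s^-1 * (s * expR (s * v)).
have isF (v : R) : is_derive v 1 F (dF v).
  have h1 := is_derive_expRM 1 v; have h2 := is_derive_expRM s v.
  have h3 := is_deriveZ s^-1 h2.
  exact: (is_deriveB h1 h3).
have cF (A : set R) : {within A, continuous F}.
  apply: continuous_subspaceT => v.
  apply/differentiable_continuous/derivable1_diffP.
  by have [] := isF v.
have dFE v : dF v = expR (s * v) * (expR ((1 - s) * v) - 1).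
  by rewrite /dF mulrA mulVf// !mul1r mulrBr -expRD mulr1; congr (expR _ - _); ring.
suff : F 0 < F w by rewrite /F !mulr0 expR0 !mul1r mulr1 mulrBl mul1r (mulrC _ s^-1); lra.
move: w0; rewrite neq_lt => /orP[w0|w0].
- have [c] := MVT w0 (fun v _ => isF v) (cF _).
  rewrite in_itv/= => /andP[_ c0] h.
  have : dF c * (0 - w) < 0.
    rewrite pmulr_llt0 ?subr_gt0// dFE pmulr_rlt0 ?expR_gt0// subr_lt0 expR_lt1.
    by rewrite pmulr_rlt0 ?subr_gt0.
  by rewrite -h; lra.
- have [c] := MVT w0 (fun v _ => isF v) (cF _).
  rewrite in_itv/= => /andP[c0 _] h.
  have : 0 < dF c * (w - 0).
    rewrite subr0 (pmulr_lgt0 _ w0) dFE pmulr_rgt0 ?expR_gt0// subr_gt0 expR_gt1.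
    by rewrite mulr_gt0 ?subr_gt0.
  by rewrite -h; lra.
Qed.

(** After division by y^{1-gam}, with w = ln (x / y), this is [expR_chord] at s = 1 - gam; the cases
    gam < 1 and gam > 1 need no separation. *)
Lemma powR_tangent gam x y : 0 < gam -> gam != 1 -> 0 < x -> 0 < y -> x != y ->
  x `^ (1 - gam) / (1 - gam) < y `^ (1 - gam) / (1 - gam) + y `^ (- gam) * (x - y).
Proof.
move=> g0 g1 x0 y0 xy.
pose w := ln x - ln y.
have w0 : w != 0.
  by rewrite subr_eq0; apply: contra xy => /eqP /ln_inj ->//; rewrite posrE.
have s1 : 1 - gam < 1 by lra.
have s0 : 1 - gam != 0 by rewrite subr_eq0 eq_sym.
have := expR_chord s1 s0 w0.
have -> : x `^ (1 - gam) = y `^ (1 - gam) * expR ((1 - gam) * w).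
  by rewrite /powR !gt_eqF// -expRD; congr expR; rewrite /w; ring.
have -> : y `^ (- gam) * (x - y) = y `^ (1 - gam) * (expR w - 1).
  have -> : x = y * expR w by rewrite -{1}(lnK x0) -{1}(lnK y0) -expRD; congr expR; rewrite /w; ring.
  rewrite -[X in _ * (_ - X)]mulr1 -mulrBr mulrA; congr (_ * _).
  by rewrite -{2}(powRr1 (ltW y0)) -powRD ?(gt_eqF y0) ?implybT//; congr powR; ring.
have p0 : 0 < y `^ (1 - gam) by rewrite powR_gt0.
set Y := y `^ _ in p0 *; set s := 1 - gam in s0 *.
rewrite -(ltr_pM2l p0) mulrA !mulrBr mulr1 !mulrBl => h.
by move: h; lra.
Qed.

(** The new case is x = 0. If gam < 1, the tangent there is y^{1-gam} (1 / (1 - gam) - 1) > 0,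
    strictly above the utility; if gam > 1, the utility is -oo. Equality thus still forces x = y. *)
Lemma util_tangent gam x y : 0 < gam -> gam != 1 -> 0 <= x -> 0 < y ->
  let T := y `^ (1 - gam) / (1 - gam) + y `^ (- gam) * (x - y) in
  (util gam x <= T%:E)%E /\ (util gam x = T%:E -> x = y).
Proof.
move=> g0 g1 x0 y0 /=; rewrite /util.
move: x0; rewrite le_eqVlt => /predU1P[<-|x0].
  rewrite ltxx; case: ifPn => g1'; last by split; rewrite ?leNye.
  have h : 0 < y `^ (1 - gam) / (1 - gam) + y `^ (- gam) * (0 - y).
    have -> : y `^ (- gam) * (0 - y) = - y `^ (1 - gam).
      rewrite sub0r mulrN -{2}(powRr1 (ltW y0)) -powRD ?(gt_eqF y0) ?implybT//; congr (- powR _ _); ring.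
    have p0 : 0 < y `^ (1 - gam) by rewrite powR_gt0.
    by rewrite subr_gt0 ltr_pdivlMr; [rewrite gtr_pMr//; lra|lra].
  by split; [rewrite lee_fin ltW|move=> /eqP; rewrite eqe => /eqP e; move: h; rewrite -e ltxx].
rewrite x0; have [->|xy] := eqVneq x y.
  by rewrite subrr mulr0 addr0; split.
have h := powR_tangent g0 g1 x0 y0 xy.
by split; [rewrite lee_fin ltW|move=> /eqP; rewrite eqe => /eqP e; move: h; rewrite e ltxx].
Qed.

Lemma measurable_util gam : measurable_fun setT (@util R gam).
Proof.
apply: measurable_fun_ifT; first exact: measurable_fun_ltr.
  apply/measurable_EFinP; apply: measurable_funM => //; exact: measurable_powR.
by case: ifP => _; exact: measurable_cst.
Qed.

End utility.

(** * Comparison of extended-real integrals, with the case of equality *)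

Section integral_comparison.
Local Open Scope ereal_scope.
Context {d : measure_display} {T : measurableType d} {R : realType}
  (mu : {measure set T -> \bar R}).

(** [g] may take the value -oo and fail to be integrable, so positive and negative parts are
    compared separately. In the case of equality the integral of [g] is finite, which makes [g]
    integrable, and the nonnegative difference m - g has integral 0. *)
Lemma integral_le_ae (D : set T) (g : T -> \bar R) (m : T -> R) : measurable D ->
  measurable_fun D g -> mu.-integrable D (EFin \o m) ->
  {ae mu, forall t, D t -> g t <= (m t)%:E} ->
  \int[mu]_(t in D) g t <= \int[mu]_(t in D) (m t)%:E /\
  (\int[mu]_(t in D) g t = \int[mu]_(t in D) (m t)%:E ->
   {ae mu, forall t, D t -> g t = (m t)%:E}).
Proof.
move=> mD mg im gm; have mm := measurable_int _ im.
have hpos : \int[mu]_(t in D) g^\+ t <= \int[mu]_(t in D) (EFin \o m)^\+ t.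
  apply: ae_ge0_le_integral => //; try exact: measurable_funepos.
  apply: filterS gm => t gmt Dt; rewrite !funeposE/=.
  by rewrite ge_max !le_max lexx (gmt Dt) orbT.
have hneg : \int[mu]_(t in D) (EFin \o m)^\- t <= \int[mu]_(t in D) g^\- t.
  apply: ae_ge0_le_integral => //; try exact: measurable_funeneg.
  apply: filterS gm => t gmt Dt; rewrite !funenegE.
  by rewrite ge_max !le_max lexx orbT leeN2 gmt.
split; first by rewrite (integralE _ _ g) [leRHS]integralE leeB.
move=> gmE.
have ig : mu.-integrable D g.
  apply/integrableP; split => //.
  have -> : \int[mu]_(t in D) `|g t| = \int[mu]_(t in D) (g^\+ t + g^\- t).
    by apply: eq_integral => t _; rewrite -[LHS]/((abse \o g) t) fune_abse.
  rewrite ge0_integralD//; [|exact: measurable_funepos|exact: measurable_funeneg].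
  have p1 : \int[mu]_(t in D) g^\+ t < +oo.
    by apply: (le_lt_trans hpos); exact: integral_funepos_lt_pinfty.
  apply: lte_add_pinfty => //.
  move: gmE; rewrite integralE => gmE; rewrite ltey; apply/eqP => gy.
  have := integrable_fin_num mD im; rewrite /= -gmE gy.
  by case: (\int[mu]_(t in D) g^\+ t) p1.
have h0 : \int[mu]_(t in D) ((EFin \o m) \- g) t = 0.
  rewrite integralB// gmE subee//; exact: (integrable_fin_num mD im).
have mB : measurable_fun D ((EFin \o m) \- g) by exact: emeasurable_funB.
have : \int[mu]_(t in D) `|((EFin \o m) \- g) t| = 0.
  rewrite -[RHS]h0; apply: ae_eq_integral => //.
    exact: (@measurableT_comp _ _ _ _ _ _ (@abse R) _ ((EFin \o m) \- g)).
  apply: filterS gm => t gmt Dt; rewrite gee0_abs//.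
  by rewrite sube_ge0 ?fin_numE/= ?orbT ?gmt.
move/(ae_eq_integral_abs mu mD mB); apply: filterS => t mg0 Dt.
move: (mg0 Dt) => /=; case: (g t) => //= r /eqP.
by rewrite -EFinB eqe subr_eq0 => /eqP ->.
Qed.

End integral_comparison.

(** * The static problem with a single budget constraint *)

Section power_utility_optimum.
Local Set Implicit Arguments.
Local Unset Strict Implicit.
Context {R : realType}.
Local Notation mu := (@lebesgue_measure R).
Local Notation D := [set t : R | 0 <= t].

Lemma measurable_halfline : measurable (D : set (measurableTypeR R)).
Proof. by rewrite -set_itvcy; exact: measurable_itv. Qed.

Lemma integral_halfline_expR (b : R) : 0 < b ->
  mu.-integrable D (EFin \o (fun t => b * expR (- b * t))) /\
  Rintegral mu D (fun t => b * expR (- b * t)) = 1.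
Proof.
move=> b0; have mD := measurable_halfline.
have h t : D t -> exponential_pdf b t = b * expR (- b * t) by move=> /exponential_pdfE ->.
split.
  apply: (@eq_integrable _ _ _ mu D _ (EFin \o exponential_pdf b)) => //.
    by move=> t; rewrite inE => /h /= ->.
  by apply: integrableS (integrable_exponential_pdf b0).
rewrite /Rintegral -[RHS]/(fine 1%E) -(integral_exponential_pdf b0).
congr fine; rewrite integral_mkcond; apply: eq_integral => t _.
rewrite patchE; case: ifPn => [|]; first by rewrite inE => /h ->.
rewrite notin_setE/= => /negP; rewrite -ltNge => t0.
by rewrite lt0_exponential_pdf.
Qed.

Variables (a rho gam V0 : R).
Hypotheses (gam_gt0 : 0 < gam) (gam_neq1 : gam != 1) (V0_gt0 : 0 < V0).
Let Gam := (a - rho) / gam.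
Hypothesis b_gt0 : 0 < a - Gam.
Let b := a - Gam.
Let K := b * V0.
Definition balanced_surplus (t : R) : R := b * V0 * expR (Gam * t).
Definition crra_payoff (z : R -> R) : \bar R := (\int[mu]_(t in D) (util gam (z t) * (expR (- rho * t))%:E))%E.
Local Notation zs := balanced_surplus.
Local Notation U := crra_payoff.
(** Shadow price of the budget: since gam Gam = a - rho, the discounted marginal utility e^{-rho t}
    zs(t)^{-gam} equals lam e^{-at}. *)
Let lam := K `^ (- gam).

Let K_gt0 : 0 < K. Proof. exact: mulr_gt0. Qed.

Let zs_powR r t : (zs t) `^ r = K `^ r * expR (r * Gam * t).
Proof.
rewrite /balanced_surplus -/K powRM ?(ltW K_gt0) ?expR_ge0//; congr (_ * _).
by rewrite /powR gt_eqF ?expR_gt0// expRK mulrA.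
Qed.

Let gamGam : gam * Gam = a - rho.
Proof. by rewrite /Gam mulrC divfK// gt_eqF. Qed.

(** The payoff of [zs]: its discounted utility flow is k1 times the exponential density b e^{-bt},
    of mass 1. *)
Let k1 := K `^ (1 - gam) / (1 - gam) / b.

(** Arranged so that, with x = z(t), the bracket integrates to lam (int e^{-as} z - V0), which the
    budget makes nonpositive. *)
Let marginal t x : ((zs t) `^ (1 - gam) / (1 - gam) + (zs t) `^ (- gam) * (x - zs t)) * expR (- rho * t) =
  k1 * (b * expR (- b * t)) + (lam * (expR (- a * t) * x) - lam * V0 * (b * expR (- b * t))).
Proof.
have e1 : expR ((1 - gam) * Gam * t) * expR (- rho * t) = expR (- b * t).
  rewrite -expRD; congr expR; transitivity ((Gam - gam * Gam - rho) * t); first by ring.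
  by rewrite gamGam /b; ring.
have e2 : expR (- gam * Gam * t) * expR (- rho * t) = expR (- a * t).
  rewrite -expRD; congr expR; transitivity ((- (gam * Gam) - rho) * t); first by ring.
  by rewrite gamGam; ring.
have e3 : expR (- a * t) * expR (Gam * t) = expR (- b * t).
  by rewrite -expRD; congr expR; rewrite /b; ring.
have e4 : k1 * b = K `^ (1 - gam) / (1 - gam) by rewrite /k1 divfK// gt_eqF.
rewrite !zs_powR [k1 * _]mulrA e4 -/lam.
transitivity (K `^ (1 - gam) / (1 - gam) * (expR ((1 - gam) * Gam * t) * expR (- rho * t)) +
  lam * (expR (- gam * Gam * t) * expR (- rho * t)) * (x - zs t)); first by ring.
rewrite e1 e2 /balanced_surplus -e3 /K; ring.
Qed.

Lemma crra_payoff_balanced : U zs = (Rintegral mu D (fun t => k1 * (b * expR (- b * t))))%:E.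
Proof.
have [ib _] := integral_halfline_expR b_gt0.
rewrite /Rintegral fineK; last first.
  apply: integrable_fin_num; first exact: measurable_halfline.
  have := integrableZl measurable_halfline k1 ib; exact.
apply: eq_integral => t _.
have zs0 : 0 < zs t by rewrite /balanced_surplus mulr_gt0 ?expR_gt0.
rewrite /util zs0 -EFinM; congr EFin; have := marginal t (zs t).
rewrite subrr mulr0 addr0 => ->; rewrite /balanced_surplus.
have -> : expR (- a * t) * (K * expR (Gam * t)) = V0 * (b * expR (- b * t)).
  have <- : expR (- a * t) * expR (Gam * t) = expR (- b * t).
    by rewrite -expRD; congr expR; rewrite /b; ring.
  by rewrite /K; ring.
by rewrite /b; ring.
Qed.

Lemma crra_optimum (z : R -> R) : measurable_fun D z ->
  {ae mu, forall t, 0 <= t -> 0 <= z t} ->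
  mu.-integrable D (EFin \o (fun t => expR (- a * t) * z t)) ->
  Rintegral mu D (fun t => expR (- a * t) * z t) <= V0 ->
  (U z <= U zs)%E /\ (U z = U zs -> {ae mu, forall t, 0 <= t -> z t = zs t}).
Proof.
move=> mz z0 iz zV.
have mD := measurable_halfline.
have [ib Ib] := integral_halfline_expR b_gt0; rewrite -/b in ib Ib.
pose m t := k1 * (b * expR (- b * t)) +
  (lam * (expR (- a * t) * z t) - lam * V0 * (b * expR (- b * t))).
pose g t := (util gam (z t) * (expR (- rho * t))%:E)%E.
have ik k : mu.-integrable D (EFin \o (fun t => k * (b * expR (- b * t)))).
  have := integrableZl mD k ib; exact.
have iz' : mu.-integrable D (EFin \o (fun t => lam * (expR (- a * t) * z t))).
  have := integrableZl mD lam iz; exact.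
have iB : mu.-integrable D (EFin \o (fun t => lam * (expR (- a * t) * z t) - lam * V0 * (b * expR (- b * t)))).
  have := integrableB mD iz' (ik (lam * V0)); exact.
have im : mu.-integrable D (EFin \o m).
  have := integrableD mD (ik k1) iB; exact.
have gm : {ae mu, forall t, 0 <= t -> (g t <= (m t)%:E)%E /\ (g t = (m t)%:E -> z t = zs t)}.
  apply: ae_imp z0 => t zt t0.
  have zs0 : 0 < zs t by rewrite /balanced_surplus mulr_gt0 ?expR_gt0.
  have [h1 h2] := util_tangent gam_gt0 gam_neq1 (zt t0) zs0.
  rewrite /g /m -marginal EFinM; split.
    by apply: lee_wpmul2r => //; rewrite lee_fin expR_ge0.
  move=> e; apply: h2; move: h1; rewrite le_eqVlt => /predU1P[//|].
  have ep : (0 < (expR (- rho * t))%:E)%E by rewrite lte_fin expR_gt0.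
  by rewrite -(lte_pmul2r _ ep)// e ltxx.
have mg : measurable_fun D g.
  apply: emeasurable_funM.
    by apply: measurableT_comp => //; exact: measurable_util.
  by apply/measurable_EFinP; apply: measurable_funTS; exact: measurable_expRM.
have [] := @integral_le_ae _ _ R mu D g m mD mg im.
  by apply: ae_imp gm => t gmt /gmt[].
have -> : (\int[mu]_(t in D) (m t)%:E)%E = (Rintegral mu D m)%:E.
  by rewrite /Rintegral fineK//; exact: integrable_fin_num.
have Im : Rintegral mu D m <= Rintegral mu D (fun t => k1 * (b * expR (- b * t))).
  have Ik k : Rintegral mu D (fun t => k * (b * expR (- b * t))) = k.
    by rewrite (RintegralZl _ mD ib) Ib mulr1.
  rewrite /m RintegralD// gerDl RintegralB// Ik (RintegralZl _ mD iz).
  by rewrite subr_le0 ler_wpM2l// powR_ge0.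
rewrite crra_payoff_balanced -/(crra_payoff z) => h1 h2; split; first by rewrite (le_trans h1)// lee_fin.
move=> h3; have {}h2 : {ae mu, forall t, D t -> g t = (m t)%:E}.
  apply: h2; apply/eqP; rewrite eq_le h1/= -/(crra_payoff z) h3.
  by rewrite lee_fin.
by apply: ae_imp2 gm h2 => t gmt gt t0; apply: (gmt t0).2; exact: gt.
Qed.

End power_utility_optimum.
(** * The habit model *)

Section model.
Local Set Implicit Arguments.
Local Unset Strict Implicit.
Context {R : realType}.
Local Notation mu := (@lebesgue_measure R).
Variables (A delta eps eta tau k0 : R) (c0 : R -> R).
Hypotheses (a_gt0 : 0 < A - delta) (eta_gt0 : 0 < eta) (tau_gt0 : 0 < tau) (eps_gt0 : 0 < eps).
Hypothesis past_c0 : past_consumption tau c0.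
Let a := A - delta.
Local Notation stock := (stock eps eta tau).
Local Notation spending := (spending a).
Local Notation wealth := (wealth a eps eta tau).
Local Notation kappa := (kappa a eps eta tau).
Implicit Types (c f : R -> R) (t u : R).

(* Cutting to 0 before - tau, where c0 carries no information, makes the whole
   consumption path locally integrable on the line. *)
Definition path c u := if u < - tau then 0 else ctilde c0 c u.

Lemma path_past c u : u < 0 -> path c u = path (fun=> 0) u.
Proof. by move=> u0; rewrite /path /ctilde u0. Qed.

Lemma path_ge0E c u : 0 <= u -> path c u = c u.
Proof.
move=> u0; rewrite /path /ctilde ltNge (le_trans _ u0) ?oppr_le0 ?(ltW tau_gt0)//=.
by rewrite ltNge u0.
Qed.

Lemma path_ctilde c u : - tau <= u -> path c u = ctilde c0 c u.
Proof. by move=> u0; rewrite /path ltNge u0. Qed.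

Let integrable_c0 : mu.-integrable `[- tau, 0[ (EFin \o c0).
Proof.
have [m0 [c0_ge0 i2]] := past_c0.
have i1 : mu.-integrable `[- tau, 0[ (EFin \o cst (1 : R)).
  have l1 : locint (cst (1 : R)).
    by apply: locint_bounded => // x y; exists 1 => u _; rewrite normr1.
  by apply: integrableS (l1 (- tau) 0) => //; exact: subset_itv_co_cc.
apply: (le_integrable _ _ _ (integrableD _ i1 i2)) => //.
- exact/measurable_EFinP.
- move=> u; rewrite /= in_itv/= => /c0_ge0 cu.
  rewrite /= lee_fin !ger0_norm ?addr_ge0 ?sqr_ge0//.
  by have := sqr_ge0 (c0 u - 1); nra.
Qed.

Lemma density_path c : control c -> density (path c).
Proof.
move=> [mc [c_ge0 ic]]; have [m0 [c0_ge0 _]] := past_c0.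
have mD : measurable ([set t : R | 0 <= t] : set (measurableTypeR R)) := measurable_halfline.
have pathE : path c = (fun u => (c0 \_ `[- tau, 0[) u + (c \_ [set t | 0 <= t]) u).
  apply/funext => u; rewrite /path /ctilde /=.
  have cI : (c0 \_ `[- tau, 0[) u = if - tau <= u < 0 then c0 u else 0.
    rewrite patchE; case: ifPn => [|/negP].
      by rewrite inE/= in_itv/= => ->.
    by rewrite inE/= in_itv/= => /negP/negbTE ->.
  have cD : (c \_ [set t : R | 0 <= t]) u = if 0 <= u then c u else 0.
    rewrite patchE; case: ifPn => [|/negP]; first by rewrite inE/= => ->.
    by rewrite inE/= => /negP/negbTE ->.
  rewrite cI cD (leNgt (- tau)) (leNgt 0); have [ut|tu] := ltP u (- tau).
    by rewrite (lt_trans ut) ?oppr_lt0//= addr0.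
  by have [u0|u0] := ltP u 0; rewrite /= ?addr0 ?add0r.
have mpath : measurable_fun setT (path c).
  rewrite pathE; apply: measurable_funD.
    by apply: (measurable_restrictT _ _).1.
  by apply: (measurable_restrictT _ _).1.
split => //.
  move=> u; rewrite /path /ctilde; case: ltP => // tu; case: ltP => [u0|]; last exact: c_ge0.
  by rewrite c0_ge0// tu.
rewrite pathE; apply: locintD => x y; rewrite -restrict_EFin; apply/integrable_restrict => //.
- by apply: integrableS integrable_c0 => //; exact: measurableI.
- have : mu.-integrable `[0, Num.max 0 y]%classic (EFin \o c) by apply: ic; rewrite le_max lexx.
  apply: integrableS => //; first exact: measurableI.
  move=> u [/=]; rewrite !in_itv/= => /andP[_ uy] u0.
  by rewrite u0 le_max uy orbT.
Qed.

Let lpath c : control c -> locint (path c).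
Proof. by move=> /density_path[]. Qed.

(** On [x, y] the habit is a difference of a primitive started at x - tau, to the left of every
    window involved. *)
Lemma locint_stock_density f : density f -> locint (stock f).
Proof.
move=> df x y; have dp := density_expRM eta df; have [_ _ lp] := dp.
pose Q u := J (fun s => expR (eta * s) * f s) (x - tau) u.
have dQ : density Q by exact: density_J.
have [_ _ lQ] := dQ.
have [_ _ lQs] : density (fun u => Q (u - tau)) by exact: density_shift.
pose g t := eps * (expR (- eta * t) * (Q t - Q (t - tau))).
have lg : locint g by apply/locintZ/locint_expRM/locintB.
apply: eq_integrable (lg x y) => // t; rewrite inE/= in_itv/= => /andP[xt _].
rewrite /g /stock /Q (@J_chasles _ _ (x - tau) (t - tau) t)//.
- by congr EFin; congr (_ * (_ * _)); ring.
- by rewrite lerB.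
- by rewrite gerBl ltW.
Qed.

Lemma habitE c t : control c -> 0 <= t -> habit eps eta tau c0 c t = stock (path c) t.
Proof.
move=> cc t0; rewrite /habit /stock; congr (_ * _).
rewrite -JZ; last exact/locint_expRM/lpath.
apply: eq_J => u /andP[tu _]; rewrite path_ctilde; last by move: tu; lra.
by rewrite mulrA -expRD mulrC; congr (expR _ * _); ring.
Qed.

Lemma capitalE c t : control c -> 0 <= t ->
  capital A delta k0 c t = expR (a * t) * (k0 - spending (path c) 0 t).
Proof.
move=> cc t0; rewrite /capital mulrBr mulrC; congr (_ - _).
rewrite /spending -JZ; last exact/locint_expRM/lpath.
apply: eq_J => u /andP[u0 _]; rewrite path_ge0E// mulrA -expRD.
by congr (expR _ * _); rewrite /a; ring.
Qed.

Lemma policyE c t : control c -> 0 <= t ->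
  capital A delta k0 c t
    - (a + eta)^-1 *
      (habit eps eta tau c0 c t
       + eps * (1 - expR (- (a + eta) * tau)) * capital A delta k0 c t
       - eps * expR (- eta * tau) * expR (- a * tau)
         * Rintegral mu `[t - tau, t]%classic
             (fun u => expR (- a * (u - t)) * ctilde c0 c u)) =
  expR (a * t) * wealth k0 (path c) t.
Proof.
move=> cc t0; have lp := lpath cc.
have -> : Rintegral mu `[t - tau, t]%classic (fun u => expR (- a * (u - t)) * ctilde c0 c u) =
    expR (a * t) * spending (path c) (t - tau) t.
  rewrite /spending -JZ; last exact: locint_expRM.
  apply: eq_J => u /andP[tu _]; rewrite path_ctilde; last by move: tu; lra.
  by rewrite mulrA -expRD; congr (expR _ * _); ring.
rewrite capitalE// habitE// /wealth /kappa.
have -> : eps * expR (- eta * tau) * expR (- a * tau) = eps * expR (- (a + eta) * tau).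
  by rewrite -mulrA -expRD; congr (_ * expR _); ring.
have e1 : expR (a * t) * expR (- a * t) = 1.
  by rewrite -expRD -[RHS]expR0; congr expR; ring.
have b0 : a + eta != 0 by exact: (lt0r_neq0 (addr_gt0 a_gt0 eta_gt0)).
apply/eqP; rewrite -subr_eq0; apply/eqP.
transitivity ((expR (a * t) * expR (- a * t) - 1) * (stock (path c) t / (a + eta))); first by field.
by rewrite e1 subrr mul0r.
Qed.

(** At u = s the left side reads [c0 0], while the path takes the value of the control there; the
    endpoint is removed from both integrals before they are compared. *)
Lemma q1E s : - tau <= s <= 0 ->
  q1 eps eta tau c0 s =
  eps * (expR (eta * s) * J (fun v => expR (eta * v) * path (fun=> 0) v) (- tau - s) 0).
Proof.
move=> /andP[ts s0].
have c00 : control (fun=> 0 : R).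
  split; first exact: measurable_cst.
  by split => // T T0; exact: integrable0.
have df := density_path c00.
have dp := density_expRM eta df; have [_ _ lp] := dp.
have dps := density_shift (- s) _ dp; have [_ _ lps] := dps.
rewrite /q1; congr (_ * _).
rewrite (J_shift (- s) _ _ _ dp) -JZ// opprK subrK add0r.
pose g u : R := expR (eta * s) * (expR (eta * (u - s)) * path (fun=> 0) (u - s)).
have lg : locint g by exact: locintZ.
have gE u : u \in (`[- tau, s[%classic : set R) -> c0 (u - s) * expR (eta * u) = g u.
  rewrite inE/= in_itv/= => /andP[tu us]; rewrite /g mulrA -expRD mulrC.
  rewrite path_ctilde; last by lra.
  rewrite /ctilde subr_lt0 us; congr (expR _ * _); ring.
rewrite -[RHS]/(Rintegral mu `[- tau, s]%classic g).
rewrite -Rintegral_itv_bndo_bndc; last first.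
  apply: (@eq_integrable _ _ _ mu _ _ (EFin \o g)) => //.
    by move=> u ui; rewrite /= (gE u ui).
  by apply: integrableS (lg (- tau) s) => //; exact: subset_itv_co_cc.
rewrite -[RHS]Rintegral_itv_bndo_bndc; last first.
  by apply: integrableS (lg (- tau) s) => //; exact: subset_itv_co_cc.
by apply: eq_Rintegral => u ui; exact: gE.
Qed.

End model.

(** * The budget constraint of admissible controls *)

Section budget.
Local Set Implicit Arguments.
Local Unset Strict Implicit.
Context {R : realType}.
Local Notation mu := (@lebesgue_measure R).
Variables (A delta eps eta tau k0 : R) (c0 : R -> R).
Hypotheses (a_gt0 : 0 < A - delta) (eta_gt0 : 0 < eta) (tau_gt0 : 0 < tau) (eps_gt0 : 0 < eps).
Hypothesis past_c0 : past_consumption tau c0.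
Local Notation a := (A - delta).
Local Notation beta := (A - delta + eta).
Local Notation h := (stock eps eta tau).
Local Notation spend := (spending (A - delta)).
Local Notation W := (wealth (A - delta) eps eta tau k0).
Local Notation kap := (kappa (A - delta) eps eta tau).
Local Notation pth := (path tau c0).
Implicit Types (c f : R -> R) (t u : R).

Let beta_gt0 : 0 < beta. Proof. exact: addr_gt0. Qed.

Let beta_neq0 : beta != 0. Proof. by rewrite gt_eqF. Qed.

Let divE (x y : R) : beta * x = y -> x = y / beta.
Proof. by move=> <-; rewrite mulrC mulKf. Qed.

Lemma control0 : control (fun=> 0 : R).
Proof.
split; first exact: measurable_cst.
by split => // T T0; exact: integrable0.
Qed.

(** On u <= 0 the exponential e^{(l + eta) u} decreases in l; compare l = a with the root. *)
Lemma kappa_ge0 lam0 : 1 = eps * Rintegral mu `[- tau, 0]%classic (fun u => expR ((lam0 + eta) * u)) ->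
  lam0 <= a -> 0 <= kap.
Proof.
move=> eps1 la; have tau0 : - tau <= 0 by rewrite oppr_le0 ltW.
have h1 : J (fun u => expR (beta * u)) (- tau) 0 <= J (fun u => expR ((lam0 + eta) * u)) (- tau) 0.
  apply: le_J; [exact: locint_expR..|] => u /andP[_ u0].
  by rewrite ler_expR ler_wnM2r// lerD2r.
have := J_expR beta (- tau) 0 tau0; rewrite mulr0 expR0 mulrN -mulNr => h2.
rewrite /kappa -h2 subr_ge0 [X in _ <= X]eps1.
by rewrite [beta * _]mulrC mulrA mulfK ?gt_eqF// ler_pM2l.
Qed.

Lemma J_path_past r c : control c ->
  J (fun u => expR (r * u) * pth c u) (- tau) 0 = J (fun u => expR (r * u) * pth (fun=> 0) u) (- tau) 0.
Proof.
have lE c' : control c' -> mu.-integrable `[- tau, 0[%classic (EFin \o (fun u => expR (r * u) * pth c' u)).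
  move=> cc'; have [_ _ lf] := density_expRM r (density_path tau_gt0 past_c0 cc').
  by apply: integrableS (lf (- tau) 0) => //; exact: subset_itv_co_cc.
move=> cc; rewrite /J -Rintegral_itv_bndo_bndc; last exact: lE.
rewrite -[RHS]Rintegral_itv_bndo_bndc; last exact/lE/control0.
by apply: eq_Rintegral => u; rewrite inE/= in_itv/= => /andP[_ u0]; rewrite path_past.
Qed.

(** q1(s) is the habit that past consumption alone leaves at time -s, so the integral in G is the
    present value of the inherited habit over [0, tau]. It is computed by reflecting s to -tau - s
    and applying [P_parts]. *)
Lemma wealth0E c : control c -> W (pth c) 0 = Gfun A delta eps eta tau k0 (q1 eps eta tau c0).
Proof.
move=> cc; have tau0 : - tau <= 0 by rewrite oppr_le0 ltW.
pose f := pth (fun=> 0 : R); have df : density f := density_path tau_gt0 past_c0 control0.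
pose P u := J (fun s => expR (eta * s) * f s) (- tau) u.
have dp := density_expRM eta df; have [_ _ lp] := dp.
have dP : density P := density_J _ dp.
have dF := density_expRM (- beta) dP; have [_ _ lF] := dF.
have parts := P_parts a_gt0 eta_gt0 df (y := 0) tau0; rewrite mulr0 expR0 mul1r in parts.
have Ie : beta * J (fun s => expR (beta * s)) (- tau) 0 = 1 - expR (- beta * tau).
  by rewrite J_expR// mulr0 expR0 mulrN mulNr.
have refl := J_reflect (- tau) _ (- tau) 0 dF; rewrite subr0 opprK addNr in refl.
have ebt : expR (beta * tau) * expR (- beta * tau) = 1.
  by rewrite -expRD -[RHS]expR0; congr expR; ring.
have Iq : Rintegral mu `[- tau, 0]%classic (fun s => expR (a * s) * q1 eps eta tau c0 s) =
    eps * (P 0 * J (fun s => expR (beta * s)) (- tau) 0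
           - expR (- beta * tau) * J (fun u => expR (- beta * u) * P u) (- tau) 0).
  rewrite refl.
  have lR : locint (fun u => expR (- beta * (- tau - u)) * P (- tau - u)).
    by case: (density_reflect (- tau) _ dF).
  set Fr := fun u : R => _ in lR *; set Pe := fun s => expR (beta * s).
  have lPe : locint Pe by exact: locint_expR.
  have -> : eps * (P 0 * J Pe (- tau) 0 - expR (- beta * tau) * J Fr (- tau) 0) =
      J (fun s => eps * (P 0 * Pe s - expR (- beta * tau) * Fr s)) (- tau) 0.
    rewrite JZ; last by apply: locintB; exact: locintZ.
    by rewrite JB; [rewrite !JZ|exact: locintZ..].
  rewrite -[LHS]/(J (fun s => expR (a * s) * q1 eps eta tau c0 s) (- tau) 0).
  apply: eq_J => s s_in; rewrite /Fr /Pe.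
  have /andP[ts s0] := s_in.
  rewrite (q1E eps eta tau_gt0 past_c0 s_in).
  have tts : - tau <= - tau - s by rewrite lerDl oppr_ge0.
  have ts' : - tau - s <= 0 by rewrite subr_le0.
  have -> : J (fun v => expR (eta * v) * f v) (- tau - s) 0 = P 0 - P (- tau - s).
    by rewrite /P (J_chasles lp tts ts') [RHS]addrC addKr.
  have -> : expR (- beta * (- tau - s)) = expR (beta * tau) * expR (beta * s).
    by rewrite -expRD; congr expR; ring.
  have -> : expR (- beta * tau) * (expR (beta * tau) * expR (beta * s) * P (- tau - s)) =
     expR (beta * s) * P (- tau - s).
    by rewrite !mulrA [expR (- beta * tau) * _]mulrC ebt mul1r.
  have -> : expR (beta * s) = expR (a * s) * expR (eta * s).
    by rewrite -expRD; congr expR; ring.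
  by ring.
rewrite /Gfun Iq /wealth /spending J_refl subr0 mulr0 expR0 mul1r sub0r.
rewrite /stock mulr0 expR0 mul1r sub0r (J_path_past eta cc) (J_path_past (- a) cc) -/f -/(P 0).
rewrite (divE Ie) (divE parts) -[Rintegral _ _ _]/(J (fun s => expR (beta * s)) (- tau) 0) (divE Ie).
rewrite /kappa -/(spend f (- tau) 0).
rewrite -/(P 0).
by field.
Qed.

(** Relative to discounted consumption, the discounted habit has weight eps e^{beta (u - t)}, which
    lies between eps e^{-beta tau} and eps on the window. This gives this bound and the next one. *)
Lemma stock_le_spend f t : density f -> expR (- a * t) * h f t <= eps * spend f (t - tau) t.
Proof.
move=> [_ f0 lf]; rewrite /stock /spending mulrCA ler_pM2l// mulrA -expRD -JZ; last exact: locint_expRM.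
apply: le_J; [exact/locintZ/locint_expRM|exact: locint_expRM|] => u /andP[_ ut].
rewrite mulrA -expRD ler_wpM2r// ler_expR.
have : beta * (u - t) <= 0 by rewrite pmulr_rle0// subr_le0.
by lra.
Qed.

Lemma spend_le_stock f t : density f ->
  eps * expR (- beta * tau) * spend f (t - tau) t <= expR (- a * t) * h f t.
Proof.
move=> [_ f0 lf]; rewrite /stock /spending [leRHS]mulrCA -mulrA ler_pM2l// [leRHS]mulrA -expRD.
rewrite -!JZ; [|exact: locint_expRM..].
apply: le_J; [exact/locintZ/locint_expRM|exact/locintZ/locint_expRM|] => u /andP[tu _].
rewrite !mulrA -!expRD ler_wpM2r// ler_expR.
have : 0 <= beta * (u - (t - tau)) by rewrite pmulr_rge0// subr_ge0.
by lra.
Qed.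

(* Past consumption within the delay weighs more in the habit than in the last term
   of [wealth], so positive wealth forces positive capital. *)
Lemma capital_ge_wealth c t : control c -> 0 <= t ->
  W (pth c) t <= kap * (k0 - spend (pth c) 0 t).
Proof.
move=> cc t0; have df := density_path tau_gt0 past_c0 cc.
have := spend_le_stock t df; rewrite /wealth -subr_ge0 => h1.
have : 0 <= (expR (- a * t) * h (pth c) t - eps * expR (- beta * tau) * spend (pth c) (t - tau) t) / beta.
  by rewrite divr_ge0// ltW.
by rewrite mulrBl; lra.
Qed.

(** Admissibility gives c >= h only a.e.; clipping at 0 makes the function nonnegative everywhere
    and leaves its integrals unchanged for admissible controls. *)
Definition discounted_surplus c t := expR (- a * t) * Num.max 0 (pth c t - stock_from eps eta tau (pth c) t).

Lemma density_surplus c : control c -> density (discounted_surplus c).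
Proof.
move=> cc; have df := density_path tau_gt0 past_c0 cc.
have dS := density_stock_from eta tau_gt0 eps_gt0 df.
apply: density_expRM; have [mf f0 _] := df; have [mS S0 _] := dS.
apply: (density_le _ _ df).
- by apply: measurable_maxr => //; exact: measurable_funB.
- by move=> u; rewrite le_max lexx.
- by move=> u; rewrite ge_max f0 gerBl S0.
Qed.

Lemma eq_J_ae f g x y : measurable_fun setT f -> measurable_fun setT g ->
  {ae mu, forall u, x <= u -> f u = g u} -> J f x y = J g x y.
Proof.
move=> mf mg fg; congr fine; apply: ae_eq_integral => //.
- by apply/measurable_EFinP; exact: measurable_funTS.
- by apply/measurable_EFinP; exact: measurable_funTS.
- by apply: ae_imp fg => u fgu /=; rewrite in_itv/= => /andP[xu _]; rewrite fgu.
Qed.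

Lemma admissible_surplus c : admissible A delta eps eta tau k0 c0 c ->
  {ae mu, forall t, 0 <= t -> 0 <= pth c t - stock_from eps eta tau (pth c) t}.
Proof.
move=> [cc [_ hc]]; apply: ae_imp hc => t hct t0.
have df := density_path tau_gt0 past_c0 cc.
rewrite -stock_fromE// -(habitE eps eta tau_gt0 past_c0 cc t0) path_ge0E//.
by rewrite subr_ge0; exact: hct.
Qed.

Lemma J_surplus c T : admissible A delta eps eta tau k0 c0 c -> 0 <= T ->
  J (discounted_surplus c) 0 T = W (pth c) 0 - W (pth c) T.
Proof.
move=> adm T0; have [cc [_ hc]] := adm.
have df := density_path tau_gt0 past_c0 cc.
have dS := density_stock_from eta tau_gt0 eps_gt0 df.
have ls := locint_stock_density eps eta tau_gt0 df.
rewrite (wealth_dynamics a_gt0 eta_gt0 tau_gt0 k0 df ls T0).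
rewrite opprB addrC subrK.
have -> : J (fun u => expR (- a * u) * (pth c u - h (pth c) u)) 0 T =
    J (fun u => expR (- a * u) * (pth c u - stock_from eps eta tau (pth c) u)) 0 T.
  by apply: eq_J => u /andP[u0 _]; rewrite -stock_fromE.
have [mf _ _] := df; have [mS _ _] := dS.
apply: eq_J_ae.
- by case: (density_surplus cc).
- by apply: measurable_funM; [exact: measurable_expRM|exact: measurable_funB].
- by apply: ae_imp (admissible_surplus adm) => u zu u0; rewrite /discounted_surplus max_r// zu.
Qed.

(* The excess of discounted surplus over initial wealth is bounded by a multiple of
   the discounted spending over the last delay interval; were it positive, adding
   these intervals would give infinite discounted spending. *)
Lemma J_surplus_le c T : 0 <= kap -> admissible A delta eps eta tau k0 c0 c -> 0 <= T ->
  J (discounted_surplus c) 0 T <= W (pth c) 0.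
Proof.
move=> kap0 adm T0; have [cc [hk hc]] := adm.
have df := density_path tau_gt0 past_c0 cc.
have dz := density_surplus cc.
have budget t : 0 <= t -> spend (pth c) 0 t <= k0.
  move=> t0; have := hk t t0; rewrite (capitalE A delta k0 tau_gt0 past_c0 cc t0).
  by rewrite pmulr_rge0 ?expR_gt0// subr_ge0.
have step t : 0 <= t -> J (discounted_surplus c) 0 t - W (pth c) 0 <= eps / beta * spend (pth c) (t - tau) t.
  move=> t0; rewrite J_surplus// addrC addKr.
  have h1 : 0 <= kap * (k0 - spend (pth c) 0 t) by rewrite mulr_ge0// subr_ge0 budget.
  have h2 : expR (- a * t) * h (pth c) t / beta <= eps / beta * spend (pth c) (t - tau) t.
    by rewrite [leRHS]mulrAC ler_pM2r ?invr_gt0// stock_le_spend.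
  have h3 : 0 <= eps * expR (- beta * tau) / beta * spend (pth c) (t - tau) t.
    rewrite mulr_ge0 ?spending_ge0// divr_ge0 ?(ltW beta_gt0)//.
    by rewrite mulr_ge0 ?expR_ge0// ltW.
  by rewrite /wealth; lra.
rewrite leNgt; apply/negP => TV.
(* [beta / eps] inverts the factor in [step]. The excess at [T] persists later, the integrand being
   nonnegative, so each subsequent window carries spending at least [th]. *)
pose th := (J (discounted_surplus c) 0 T - W (pth c) 0) * (beta / eps).
have th0 : 0 < th by rewrite mulr_gt0 ?subr_gt0// divr_gt0.
have grow n : n%:R * th <= spend (pth c) 0 (T + n%:R * tau).
  elim: n => [|n IH]; first by rewrite mul0r spending_ge0.
  have Tn : 0 <= T + n%:R * tau by rewrite addr_ge0// mulr_ge0// ltW.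
  have eT : T + n.+1%:R * tau = T + n%:R * tau + tau by rewrite -natr1 mulrDl mul1r addrA.
  have TnS : T + n%:R * tau <= T + n.+1%:R * tau by rewrite eT lerDl ltW.
  have nS : n.+1%:R * th = n%:R * th + th by rewrite -natr1 mulrDl mul1r.
  rewrite (spendingD a df Tn TnS) nS lerD//.
  have := step _ (le_trans Tn TnS); rewrite {2}eT addrK.
  have h1 : J (discounted_surplus c) 0 T <= J (discounted_surplus c) 0 (T + n.+1%:R * tau).
    by apply: le_J_itv => //; rewrite lerDl mulr_ge0// ltW.
  move=> h2; rewrite /th -ler_pdivlMr ?divr_gt0// invf_div [leRHS]mulrC.
  by apply: (le_trans _ h2); rewrite lerB.
have := le_trans (grow (Num.bound (k0 / th))) (budget _ _).
move/(_ (addr_ge0 T0 (mulr_ge0 (ler0n _ _) (ltW tau_gt0)))).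
rewrite -ler_pdivlMr//.
have k0_ge0 : 0 <= k0 by apply: le_trans (budget 0 (lexx 0)); exact: spending_ge0.
by rewrite leNgt archi_boundP// divr_ge0// ltW.
Qed.

Lemma surplus_budget c : 0 <= kap -> admissible A delta eps eta tau k0 c0 c ->
  mu.-integrable [set t : R | 0 <= t] (EFin \o discounted_surplus c) /\
  Rintegral mu [set t : R | 0 <= t] (discounted_surplus c) <= W (pth c) 0.
Proof.
move=> kap0 adm; have [cc _] := adm.
have [mz z0 lz] := density_surplus cc.
have le : (\int[mu]_(t in [set t : R | (0 <= t)%R]) (discounted_surplus c t)%:E <= (W (pth c) 0)%:E)%E.
  have DE : [set t : R | 0 <= t] = \bigcup_n (`[0, n%:R]%classic : set R).
    apply/seteqP; split => t /=.
      move=> t0; exists (Num.bound t) => //=; rewrite in_itv/= t0/= ltW//.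
      exact: archi_boundP.
    by move=> [n _]/=; rewrite in_itv/= => /andP[].
  rewrite DE.
  have cv := @ge0_nondecreasing_set_cvg_integral _ _ R
    (fun n => `[0, n%:R]%classic : set (measurableTypeR R)) (EFin \o discounted_surplus c) mu.
  have {}cv : (\int[mu]_(t in `[0%R, n%:R]) (discounted_surplus c t)%:E)%E @[n --> \oo] -->
      (\int[mu]_(t in \bigcup_n (`[0%R, n%:R]%classic : set R)) (discounted_surplus c t)%:E)%E.
    apply: cv => //.
    - move=> m n mn; apply/subsetPset; apply: subset_itvl.
      by rewrite bnd_simp ler_nat.
    - by move=> n; apply/measurable_EFinP; exact: measurable_funTS.
    - by move=> n t _; rewrite lee_fin.
  rewrite -(cvg_lim _ cv)//; apply: lime_le; first by apply/cvg_ex; eexists; exact: cv.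
  by apply: nearW => n; rewrite -EFin_J// lee_fin J_surplus_le.
have iz : mu.-integrable [set t : R | 0 <= t] (EFin \o discounted_surplus c).
  apply/integrableP; split; first by apply/measurable_EFinP; exact: measurable_funTS.
  under eq_integral do rewrite /= ger0_norm//.
  by apply: (le_lt_trans le); rewrite ltry.
split => //; rewrite -lee_fin /Rintegral fineK//.
by apply: integrable_fin_num => //; exact: measurable_halfline.
Qed.

End budget.

(** * The optimal path and its characterisation by the policy *)

Section optimum.
Local Set Implicit Arguments.
Local Unset Strict Implicit.
Context {R : realType}.
Local Notation mu := (@lebesgue_measure R).
Variables (A delta rho eps eta tau gam k0 : R) (c0 : R -> R).
Hypotheses (a_gt0 : 0 < A - delta) (eta_gt0 : 0 < eta) (tau_gt0 : 0 < tau) (eps_gt0 : 0 < eps).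
Hypotheses (gam_gt0 : 0 < gam) (gam_neq1 : gam != 1).
Hypothesis past_c0 : past_consumption tau c0.
Local Notation a := (A - delta).
Local Notation Gam := ((A - delta - rho) / gam).
Local Notation b := (A - delta - (A - delta - rho) / gam).
Hypothesis b_gt0 : 0 < b.
Hypothesis kap0 : 0 <= kappa (A - delta) eps eta tau.
Local Notation V0 := (Gfun A delta eps eta tau k0 (q1 eps eta tau c0)).
Hypothesis V0_gt0 : 0 < V0.
Local Notation h := (stock eps eta tau).
Local Notation W := (wealth (A - delta) eps eta tau k0).
Local Notation pth := (path tau c0).
Local Notation zs := (balanced_surplus (A - delta) rho gam V0).
Implicit Types (c f : R -> R) (t u : R).

Let zs_gt0 t : 0 < zs t. Proof. by rewrite /balanced_surplus mulr_gt0 ?expR_gt0// mulr_gt0. Qed.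

Let disc_zs t : expR (- a * t) * zs t = V0 * (b * expR (- b * t)).
Proof.
rewrite /balanced_surplus.
have <- : expR (- a * t) * expR (Gam * t) = expR (- b * t).
  by rewrite -expRD; congr expR; ring.
by ring.
Qed.

Let J_zs t : 0 <= t -> J (fun u => expR (- a * u) * zs u) 0 t = V0 - V0 * expR (- b * t).
Proof.
move=> t0; under eq_fun do rewrite disc_zs.
rewrite (_ : (fun u => _) = (fun u => V0 * b * expR (- b * u))); last first.
  by apply/funext => u; rewrite mulrA.
rewrite JZ; last exact: locint_expR.
have := J_expR (- b) 0 t t0; rewrite mulr0 expR0 => e.
by rewrite -mulrA -[b]opprK mulNr opprK e; ring.
Qed.

Lemma surplus_path_exists : exists c, control c /\
  forall t, 0 <= t -> c t = zs t + h (pth c) t.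
Proof.
have dp := density_path tau_gt0 past_c0 (@control0 R).
have bV : 0 <= b * V0 by rewrite mulr_ge0// ltW.
(* The rate [|Gam| + 2 * eps] dominates the growth of [zs] for either sign of Gam and meets the
   condition L >= 2 eps. *)
have [||||||g [dg gp gh]] := @stock_fixpoint R eps eta tau eta_gt0 tau_gt0 eps_gt0
    (pth (fun=> 0)) zs (b * V0) (`|Gam| + 2 * eps) dp.
- by move=> u u0; rewrite path_ge0E.
- by apply: measurable_funM => //; exact: measurable_expRM.
- by move=> u; exact: ltW.
- move=> u u0; rewrite /balanced_surplus ler_wpM2l// ler_expR ler_wpM2r//.
  by rewrite (le_trans (ler_norm _))// lerDl mulr_ge0// ltW.
- exact: bV.
- by rewrite lerDr.
exists g; have pg : pth g = g.
  apply/funext => u; have [u0|u0] := ltP u 0; last by rewrite path_ge0E.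
  by rewrite path_past// -gp.
split; last by move=> t t0; rewrite pg gh.
have [mg g0 lg] := dg; split; first exact: measurable_funTS.
by split => [t _|T _]; [exact: g0|exact: lg].
Qed.

Lemma wealth_surplus c t : control c ->
  (forall u, 0 <= u -> c u = zs u + h (pth c) u) -> 0 <= t ->
  W (pth c) t = V0 * expR (- b * t).
Proof.
move=> cc ch t0; have df := density_path tau_gt0 past_c0 cc.
have ls := locint_stock_density eps eta tau_gt0 df.
rewrite (wealth_dynamics a_gt0 eta_gt0 tau_gt0 k0 df ls t0).
rewrite (wealth0E eps k0 a_gt0 eta_gt0 tau_gt0 past_c0 cc).
rewrite (@eq_J _ (fun u => expR (- a * u) * zs u)); first by rewrite J_zs//; ring.
by move=> u /andP[u0 _]; rewrite path_ge0E// ch// addrK.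
Qed.

Lemma surplus_path_admissible c : control c ->
  (forall t, 0 <= t -> c t = zs t + h (pth c) t) ->
  admissible A delta eps eta tau k0 c0 c.
Proof.
move=> cc ch; split => //; split.
  move=> t t0; rewrite (capitalE A delta k0 tau_gt0 past_c0 cc t0) mulr_ge0 ?expR_ge0//.
  have := capital_ge_wealth k0 a_gt0 eta_gt0 tau_gt0 eps_gt0 past_c0 cc t0.
  (* Wealth is positive here, whereas negative capital times the nonnegative [kappa] would be at
     most 0. *)
  rewrite wealth_surplus// => kW; rewrite leNgt; apply/negP => kn.
  move: kW; apply/negP; rewrite -ltNge.
  rewrite (@le_lt_trans _ _ 0)//; last by rewrite mulr_gt0 ?expR_gt0.
  by rewrite mulr_ge0_le0// ltW.
apply: aeW => t t0; rewrite (habitE eps eta tau_gt0 past_c0)//.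
by rewrite ch// lerDr ltW.
Qed.

Lemma surplus_path_policy c : control c ->
  (forall t, 0 <= t -> c t = zs t + h (pth c) t) ->
  ext_policy A delta rho eps eta tau gam k0 c0 c.
Proof.
move=> cc ch; rewrite /ext_policy /= => t t0; rewrite (policyE eps k0 a_gt0 eta_gt0 tau_gt0 past_c0 cc t0) wealth_surplus//.
rewrite (habitE eps eta tau_gt0 past_c0)// ch// addrK.
rewrite /balanced_surplus (_ : expR (Gam * t) = expR (a * t) * expR (- b * t)); last first.
  by rewrite -expRD; congr expR; ring.
by rewrite -[b * V0 * _]mulrA [b * _]mulrC mulfK ?gt_eqF//; ring.
Qed.

(* Along the policy, w = discounted wealth solves w(t) = V0 - b int_0^t w. *)
Lemma policy_surplus c : control c -> ext_policy A delta rho eps eta tau gam k0 c0 c ->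
  forall t, 0 <= t -> c t = zs t + h (pth c) t.
Proof.
move=> cc pc; have df := density_path tau_gt0 past_c0 cc.
have dS := density_stock_from eta tau_gt0 eps_gt0 df.
have ls := locint_stock_density eps eta tau_gt0 df.
have [mf f0 lf] := df; have [mS S0 lS] := dS.
have zW t : 0 <= t -> pth c t - h (pth c) t = b * (expR (a * t) * W (pth c) t).
  move=> t0; have := pc t t0; rewrite /= (policyE eps k0 a_gt0 eta_gt0 tau_gt0 past_c0 cc t0) (habitE eps eta tau_gt0 past_c0)//.
  by rewrite -(path_ge0E c0 tau_gt0 c t0) => <-; rewrite mulrC divfK// gt_eqF.
(* Discounted wealth read off the surplus through the policy; [stock_from] makes it measurable on
   the whole line, as [gronwall] requires. *)
pose w t := expR (- a * t) * (pth c t - stock_from eps eta tau (pth c) t) / b.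
have lw : locint w.
  rewrite /w; under eq_fun do rewrite mulrC.
  by apply/locintZ/locint_expRM/locintB.
have mw : measurable_fun setT w.
  apply: measurable_funM => //; apply: measurable_funM; first exact: measurable_expRM.
  exact: measurable_funB.
have wE t : 0 <= t -> w t = W (pth c) t.
  move=> t0; rewrite /w -stock_fromE// zW// [_ * (b * _)]mulrCA [b * _]mulrC mulfK ?gt_eqF//.
  by rewrite mulrA -expRD mulNr addNr expR0 mul1r.
have wJ t : 0 <= t -> w t = V0 - b * J w 0 t.
  move=> t0; rewrite wE// (wealth_dynamics a_gt0 eta_gt0 tau_gt0 k0 df ls t0).
  rewrite (wealth0E eps k0 a_gt0 eta_gt0 tau_gt0 past_c0 cc) -JZ//; congr (_ - _).
  apply: eq_J => u /andP[u0 _]; rewrite /w -stock_fromE//.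
  by rewrite [RHS]mulrC divfK// gt_eqF.
pose e u := V0 * expR (- b * u).
have le : locint e by apply/locintZ/locint_expR.
have me : measurable_fun setT e by apply: measurable_funM => //; exact: measurable_expRM.
have dd : density (fun u => `|w u - e u|).
  split => //; last by apply: locint_norm; exact: locintB.
  by apply: measurableT_comp => //; exact: measurable_funB.
have eJ t : 0 <= t -> e t = V0 - b * J e 0 t.
  move=> t0; have := J_zs t0; rewrite (@eq_J _ (fun u => b * e u)).
    by rewrite JZ// /e => ->; ring.
  by move=> u _; rewrite disc_zs /e; ring.
have gr t : 0 <= t -> `|w t - e t| <= b * J (fun u => `|w u - e u|) 0 t.
  move=> t0; rewrite (wJ t t0) (eJ t t0).
  have -> : V0 - b * J w 0 t - (V0 - b * J e 0 t) = - (b * J (fun u => w u - e u) 0 t).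
    by rewrite JB//; ring.
  rewrite normrN normrM (gtr0_norm b_gt0) ler_pM2l//.
  exact: (normr_J 0 t (locintB lw le)).
have J0 y : J (fun u => `|w u - e u|) 0 y = 0.
  by apply: (gronwall dd b_gt0); exact: aeW.
move=> t t0; have := gr t t0; rewrite J0 mulr0 normr_le0 subr_eq0 => /eqP we.
have := zW t t0; rewrite -wE// we path_ge0E// => /eqP; rewrite subr_eq => /eqP ->.
congr (_ + _); rewrite /e /balanced_surplus (_ : expR (Gam * t) = expR (a * t) * expR (- b * t)); last first.
  by rewrite -expRD; congr expR; ring.
by ring.
Qed.

Lemma surplus_path_unique c c' : control c -> control c' ->
  {ae mu, forall t, 0 <= t -> c t = zs t + h (pth c) t} ->
  (forall t, 0 <= t -> c' t = zs t + h (pth c') t) ->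
  (forall t, 0 <= t -> h (pth c) t = h (pth c') t) /\
  {ae mu, forall t, 0 <= t -> c t = c' t}.
Proof.
move=> cc cc' ch ch'.
have df := density_path tau_gt0 past_c0 cc; have df' := density_path tau_gt0 past_c0 cc'.
have [||H1 H2] := stock_unique eta_gt0 tau_gt0 eps_gt0 df df'.
- by move=> u u0; rewrite path_past// [RHS]path_past.
- apply: ae_imp ch => t cht t0; rewrite !path_ge0E//.
  by rewrite (ch' t t0) cht// !addrK.
split => //; apply: ae_imp H2 => t Ht t0.
by have := Ht t0; rewrite !path_ge0E.
Qed.

Lemma surplus_path_optimal c c' : control c' ->
  (forall t, 0 <= t -> c' t = zs t + h (pth c') t) ->
  admissible A delta eps eta tau k0 c0 c ->
  (objective eps eta tau rho gam c0 c <= objective eps eta tau rho gam c0 c')%E /\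
  (objective eps eta tau rho gam c0 c = objective eps eta tau rho gam c0 c' ->
   {ae mu, forall t, 0 <= t -> c t = c' t}).
Proof.
move=> cc' ch' adm; have [cc _] := adm.
have df := density_path tau_gt0 past_c0 cc.
have dS := density_stock_from eta tau_gt0 eps_gt0 df.
have [mf f0 lf] := df; have [mS S0 lS] := dS.
pose z t := Num.max 0 (pth c t - stock_from eps eta tau (pth c) t).
have mz : measurable_fun setT z by apply: measurable_maxr => //; exact: measurable_funB.
have [iz Iz] := surplus_budget a_gt0 eta_gt0 tau_gt0 eps_gt0 past_c0 kap0 adm.
rewrite (wealth0E eps k0 a_gt0 eta_gt0 tau_gt0 past_c0 cc) in Iz.
have adz := admissible_surplus tau_gt0 past_c0 adm.
have oz : objective eps eta tau rho gam c0 c =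
    (\int[mu]_(t in [set t : R | (0 <= t)%R]) (util gam (z t) * (expR (- rho * t))%:E))%E.
  have hE t : 0 <= t -> c t - habit eps eta tau c0 c t = pth c t - stock_from eps eta tau (pth c) t.
    by move=> t0; rewrite (habitE eps eta tau_gt0 past_c0)// path_ge0E// stock_fromE.
  have mU (v : R -> R) : measurable_fun setT v ->
      measurable_fun [set t : R | 0 <= t] (fun t => util gam (v t) * (expR (- rho * t))%:E)%E.
    move=> mv; apply: measurable_funTS; apply: emeasurable_funM.
      by apply: measurableT_comp => //; exact: measurable_util.
    by apply/measurable_EFinP; exact: measurable_expRM.
  rewrite /objective.
  transitivity (\int[mu]_(t in [set t : R | (0 <= t)%R])
    (util gam (pth c t - stock_from eps eta tau (pth c) t)%R * (expR (- rho * t))%:E))%E.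
    by apply: eq_integral => t; rewrite inE => t0; rewrite hE.
  apply: ae_eq_integral.
  - exact: measurable_halfline.
  - by apply: mU; exact: measurable_funB.
  - exact: mU.
  - by apply: ae_imp adz => t zt t0; rewrite /z max_r// zt.
have oz' : objective eps eta tau rho gam c0 c' =
    (\int[mu]_(t in [set t : R | (0 <= t)%R]) (util gam (zs t) * (expR (- rho * t))%:E))%E.
  apply: eq_integral => t; rewrite inE => t0.
  by rewrite (habitE eps eta tau_gt0 past_c0 cc' t0) (ch' t t0) addrK.
have z0 : {ae mu, forall t, 0 <= t -> 0 <= z t}.
  by apply: aeW => t _; rewrite /z le_max lexx.
have [h1 h2] := crra_optimum gam_gt0 gam_neq1 V0_gt0 b_gt0 (measurable_funTS mz) z0 iz Iz.
rewrite oz oz'; split; first exact: h1.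
move=> /h2 zzs.
apply: (proj2 (surplus_path_unique cc cc' _ ch')).
apply: ae_imp2 zzs adz => t zt zt0 t0.
have := zt t0; rewrite /z (max_r (zt0 t0)) -(stock_fromE eps eta tau_gt0 df t0).
by rewrite (path_ge0E c0 tau_gt0 c t0) => <-; rewrite subrK.
Qed.

End optimum.

Theorem mainTheorem13 (R : realType) (A delta rho eps eta tau gam lam0 k0 : R)
  (c0 : R -> R) :
  0 < A -> 0 < delta -> 0 < rho -> 0 < eps -> 0 < eta -> 0 < tau ->
  0 < gam -> gam != 1 ->
  1 = eps * Rintegral lebesgue_measure `[- tau, 0]%classic
              (fun u => expR ((lam0 + eta) * u)) ->
  lam0 < eps - eta -> eps - eta <= 0 -> 0 < A - delta ->
  rho > (A - delta) * (1 - gam) ->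
  0 < k0 -> past_consumption tau c0 ->
  in_I A delta eps eta tau k0 (q1 eps eta tau c0) ->
  exists cs : R -> R,
    [/\ optimal A delta rho eps eta tau gam k0 c0 cs,
        ext_policy A delta rho eps eta tau gam k0 c0 cs,
        (forall c, optimal A delta rho eps eta tau gam k0 c0 c ->
           {ae lebesgue_measure, forall t, 0 <= t -> c t = cs t}) &
        (forall c, admissible A delta eps eta tau k0 c0 c ->
           ext_policy A delta rho eps eta tau gam k0 c0 c ->
           forall t, 0 <= t -> c t = cs t)].
Proof.
move=> _ _ _ eps_gt0 eta_gt0 tau_gt0 gam_gt0 gam_neq1 lam0E lam0_lt eps_eta a_gt0 rho_gt _ past_c0 [V0_gt0 _].
have b_gt0 : 0 < A - delta - (A - delta - rho) / gam.
  by rewrite subr_gt0 ltr_pdivrMr//; move: rho_gt; lra.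
have lam0_le : lam0 <= A - delta.
  exact: (ltW (lt_trans (lt_le_trans lam0_lt eps_eta) a_gt0)).
have kap0 := kappa_ge0 a_gt0 eta_gt0 tau_gt0 eps_gt0 lam0E lam0_le.
have [cs [ccs csE]] := surplus_path_exists eta_gt0 tau_gt0 eps_gt0 past_c0 b_gt0 V0_gt0.
have adm := surplus_path_admissible a_gt0 eta_gt0 tau_gt0 eps_gt0 past_c0 b_gt0 kap0 V0_gt0 ccs csE.
have opt c := surplus_path_optimal a_gt0 eta_gt0 tau_gt0 eps_gt0 gam_gt0 gam_neq1 past_c0 b_gt0 kap0 V0_gt0 (c := c) ccs csE.
exists cs; split.
- split; first exact: adm.
  by move=> c /opt[best _]; exact: best.
- exact: (surplus_path_policy a_gt0 eta_gt0 tau_gt0 past_c0 b_gt0 ccs csE).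
- move=> c [cadm cbest]; have [ub eq_ae] := opt c cadm.
  apply: eq_ae; apply/eqP; rewrite eq_le; apply/andP.
  by split; [exact: ub|exact: (cbest cs adm)].
- move=> c [cc _] cpol.
  have cE := policy_surplus a_gt0 eta_gt0 tau_gt0 eps_gt0 past_c0 b_gt0 cc cpol.
  (* Both paths are the same surplus plus their own habit at every t, so equality of the habits
     everywhere gives pointwise equality of consumption. *)
  have [hE _] := surplus_path_unique eta_gt0 tau_gt0 eps_gt0 past_c0 cc ccs (aeW lebesgue_measure cE) csE.
  by move=> t t0; rewrite (cE t t0) (csE t t0) (hE t t0).
Qed.
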